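(* In $\mathbb{R}^2$ there exist multi-phase quadrature domains with a triple junction point that does not touch the support of the measures. That is, there exist $m\ge 3$, bounded positive measures $\mu_1,\dots,\mu_m$ on $\mathbb{R}^2$, positive constants $\lambda_1,\dots,\lambda_m$, an $m$-phase quadrature domain $\{\Omega_i\}_{i=1}^m$ with respect to $\{\mu_i\}_{i=1}^m$ and $\{\lambda_i\}_{i=1}^m$, and a point $x^0\in\mathbb{R}^2$ which belongs to $\partial\Omega_i$ for exactly three indices $i$ and satisfies $x^0\notin\bigcup_{i=1}^m\operatorname{supp}(\mu_i)$.
   Context: $HL^1(\Omega)$ denotes the class of integrable harmonic functions over the open set $\Omega$. Multi-phase quadrature domain: given $m$ bounded positive measures $\mu_i$, positive constants $\lambda_i$, and pairwise disjoint domains $\Omega_i$ with $\operatorname{supp}(\mu_i)\subset\Omega_i$, the family $\{\Omega_i\}_{i=1}^m$ is called an $m$-phase quadrature domain with respect to $\{\mu_i\}$ and $\{\lambda_i\}$ if for each $i\ne j$ $$\int_{\Omega_i}h\lambda_i\,dx-\int_{\Omega_j}h\lambda_j\,dx=\int h\,d(\mu_i-\mu_j)$$ for every $h\in HL^1(\Omega_i\cup\Omega_j)$ that is continuous across $\partial\Omega_i\cap\partial\Omega_j$ (i.e. $h$ has a continuous extension to $\Omega_i\cup\Omega_j\cup(\partial\Omega_i\cap\partial\Omega_j)\cup\bigcup_{k\ne i,j}\partial\Omega_k$) and satisfies $h=0$ on $\bigcup_{k\neq i,j}\partial\Omega_k$. A junction point is a point where several phases meet, i.e. which lies on the boundaries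 of several of the $\Omega_i$; it is a triple junction point if three phases meet there. *)

(* Defs.v *)
From HB Require Import structures.
From mathcomp Require Export all_boot all_order all_algebra.
From mathcomp Require Export all_classical all_reals all_analysis.
Set Implicit Arguments.
Unset Strict Implicit.
Unset Printing Implicit Defensive.
Import Order.TTheory GRing.Theory Num.Theory.
Import numFieldTopology.Exports numFieldNormedType.Exports.
Local Open Scope classical_set_scope.
Local Open Scope ring_scope.

(* Points live in (R * R)%type, which carries the product (normed) topology;
   measurableTypeR R is R itself with its Borel sigma-algebra, so that plane R
   is convertible to (R * R)%type and carries the Borel sigma-algebra of R^2. *)
Definition plane (R : realType) := (measurableTypeR R * measurableTypeR R)%type.

Definition area (R : realType) : {measure set (plane R) -> \bar R} :=
  (@lebesgue_measure R \x @lebesgue_measure R)%E.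

Definition boundary (T : topologicalType) (A : set T) : set T :=
  closure A `\` interior A.

Definition domain (T : topologicalType) (A : set T) : Prop :=
  [/\ A !=set0, open A & connected A].

Definition supp (R : realType) (mu : {measure set (plane R) -> \bar R}) :
    set (R * R) :=
  [set x | forall U : set (R * R), open U -> U x -> (0 < mu U)%E].

Definition partial1 (R : realType) (h : R * R -> R) : R * R -> R :=
  fun x => 'D_((1, 0) : R * R) (h : R * R -> R^o) x.
Definition partial2 (R : realType) (h : R * R -> R) : R * R -> R :=
  fun x => 'D_((0, 1) : R * R) (h : R * R -> R^o) x.

(* For U open, this is membership of h in C^1(U): both first partial
   derivatives exist and are continuous on U. *)
Definition C1_on (R : realType) (U : set (R * R)) (h : R * R -> R) : Prop :=
  forall x, U x ->
    [/\ derivable (h : R * R -> R^o) x ((1, 0) : R * R),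
        derivable (h : R * R -> R^o) x ((0, 1) : R * R),
        {for x, continuous (partial1 h)} & {for x, continuous (partial2 h)}].

(* Twice continuously differentiable, with vanishing Laplacian. *)
Definition harmonic_on (R : realType) (U : set (R * R)) (h : R * R -> R) :
    Prop :=
  [/\ C1_on U h, C1_on U (partial1 h), C1_on U (partial2 h) &
      forall x, U x -> partial1 (partial1 h) x + partial2 (partial2 h) x = 0].

(* The class HL^1(U); values of h outside U are irrelevant. *)
Definition HL1 (R : realType) (U : set (R * R)) (h : R * R -> R) : Prop :=
  harmonic_on U h /\ (area R).-integrable U (EFin \o (h : plane R -> R)).

Section MultiPhase.
Context (R : realType) (m : nat).
Variables (mu : 'I_m -> {finite_measure set (plane R) -> \bar R})
          (lambda : 'I_m -> R) (Omega : 'I_m -> set (R * R)).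

Definition other_boundaries (i j : 'I_m) : set (R * R) :=
  \bigcup_(k in [set k : 'I_m | k != i /\ k != j]) boundary (Omega k).

(* The test functions for the pair (i, j); H is the continuous extension of h
   through which h has values on the boundaries. *)
Definition test_function (i j : 'I_m) (h : R * R -> R) : Prop :=
  HL1 (Omega i `|` Omega j) h /\
  exists H : R * R -> R,
    [/\ forall x, (Omega i `|` Omega j) x -> H x = h x,
        {within Omega i `|` Omega j
                `|` (boundary (Omega i) `&` boundary (Omega j))
                `|` other_boundaries i j, continuous H} &
        forall x, other_boundaries i j x -> H x = 0].

(* mu_i and mu_j are concentrated on Omega_i `|` Omega_j, where h is defined.
   Integrability of h is part of the identity, so that its right-hand side
   is a genuine integral against the signed measure mu_i - mu_j. *)
Definition quadrature_identity (i j : 'I_m) (h : R * R -> R) : Prop :=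
  let U : set (plane R) := Omega i `|` Omega j in
  [/\ (mu i).-integrable U (EFin \o (h : plane R -> R)),
      (mu j).-integrable U (EFin \o (h : plane R -> R)) &
      \int[area R]_(x in (Omega i : set (plane R))) (h x * lambda i)
      - \int[area R]_(x in (Omega j : set (plane R))) (h x * lambda j)
      = \int[mu i]_(x in U) h x - \int[mu j]_(x in U) h x].

(* The measures are bounded by their type. *)
Definition multiphase_quadrature_domain : Prop :=
  [/\ forall i, domain (Omega i),
      forall i j, i != j -> Omega i `&` Omega j = set0,
      forall i, supp (mu i) `<=` Omega i &
      forall i j, i != j ->
        forall h, test_function i j h -> quadrature_identity i j h].

End MultiPhase.

(* Main.v *)
(** Take m = 3, all lambda_i = 1, Omega_i the three open sectors of opening
   2 pi / 3 with vertex 0, and mu_i the Dirac mass at the point of the axis of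
   Omega_i at distance 1 from 0.  A test function h for the pair (i, j) vanishes
   on the boundary of the third sector, so the difference g of h and of its
   mirror image in the common side is harmonic and integrable on a sector and
   vanishes on its boundary.  Such a g is 0, hence h is symmetric and both sides
   of the quadrature identity are 0.

   To see g <= 0 on the sector |y| < k x, fix e > 0 and extend
   v = eta (g - e) by 0, where eta is C^2, convex, zero on the negative reals
   and satisfies eta s <= s for s >= 0: v is C^2, subharmonic and integrable on
   the plane.  Let M x be the integral of v (x, _), a function with compact
   support.  Then M'' is the integral of v_xx >= - v_yy, so M'' >= 0; as M' 0 = 0,
   M is nondecreasing, and being integrable it must vanish. *)
Require Import Defs.
From mathcomp Require Import measurable_realfun ring lra.
Set Implicit Arguments.
Unset Strict Implicit.
Unset Printing Implicit Defensive.
Import Order.TTheory GRing.Theory Num.Theory.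
Import numFieldTopology.Exports numFieldNormedType.Exports.
Local Open Scope classical_set_scope.
Local Open Scope ring_scope.

(** * The integral argument on a cone *)

Lemma continuous_slice2 (R : realType) (f : R * R -> R) (x : R) :
  continuous f -> continuous (fun y => f (x, y)).
Proof.
move=> cf y; apply: (@continuous_comp _ _ _ (fun y => (x, y)) f); last exact: cf.
exact: (cvg_pair (cvg_cst x) (@cvg_id _ (nbhs y))).
Qed.

Lemma continuous_integrable_itv (R : realType) (f : R -> R) (a b : R) :
  continuous f ->
  (@lebesgue_measure R).-integrable `[a, b] (EFin \o f).
Proof.
move=> cf; apply: continuous_compact_integrable; first exact: segment_compact.
exact: continuous_subspaceT.
Qed.

(** On the compact rectangle with sides [[x - 1, x + 1]] and [[a, b]] the continuous [f1] is
    bounded, so a constant dominates it and differentiation under the integral applies. *)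
Lemma is_derive_integral_param (R : realType) (f f1 : R * R -> R) (a b x : R) :
  continuous f -> continuous f1 ->
  (forall x y : R, is_derive x (1 : R) (fun t : R => f (t, y) : R^o) (f1 (x, y))) ->
  is_derive x (1 : R)
    (fun t : R => \int[@lebesgue_measure R]_(y in `[a, b]) f (t, y) : R^o)
    (\int[@lebesgue_measure R]_(y in `[a, b]) f1 (x, y)).
Proof.
move=> cf cf1 df.
have cK : compact (`[x - 1, x + 1] `*` `[a, b] : set (R * R)).
  by apply: compact_setX; exact: segment_compact.
have /compact_bounded[M [_ HM]] :=
  continuous_compact (continuous_subspaceT cf1) cK.
have HM' u y : u \in `]x - 1, x + 1[%R -> `[a, b]%classic y ->
    `|f1 (u, y)| <= `|M| + 1.
  move=> /subset_itv_oo_cc ux yab.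
  by apply: HM; [rewrite (le_lt_trans (ler_norm _)) ?ltrDl|exists (u, y)].
pose F t y := f (t, y).
have dF t y : partial1of2 F t y = f1 (t, y).
  by rewrite /partial1of2 derive1E; have [_ ->] := df t y.
have mI : measurable (`[a, b]%classic : set (measurableTypeR R)) by [].
have Ia : `]x - 1, x + 1[%classic x.
  by rewrite /= in_itv/= ltrBlDr !ltrDl ltr01.
have intF u : `]x - 1, x + 1[%classic u ->
    (@lebesgue_measure R).-integrable `[a, b] (EFin \o F u).
  by move=> _; apply: continuous_integrable_itv; exact: continuous_slice2.
have derF u y : `]x - 1, x + 1[%classic u -> `[a, b]%classic y ->
   derivable (F ^~ y) u 1.
  by move=> _ _; have [] := df u y.
have intG : (@lebesgue_measure R).-integrable `[a, b] (EFin \o cst (`|M| + 1)).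
  by apply: continuous_integrable_itv; exact: cst_continuous.
have G0 (y : measurableTypeR R) : 0 <= cst (`|M| + 1) y by rewrite addr_ge0.
have GF u y : `]x - 1, x + 1[%classic u -> `[a, b]%classic y ->
    `|partial1of2 F u y| <= cst (`|M| + 1) y.
  by move=> ux yab; rewrite dF; exact: HM'.
apply: DeriveDef.
  exact: (derivable_under_integral mI Ia intF derF G0 intG GF).
rewrite -derive1E (differentiation_under_integral mI Ia intF derF G0 intG GF).
by apply: eq_Rintegral => y _; exact: dF.
Qed.

Lemma FTC2_vanishing_ends (R : realType) (f f' : R -> R) (a b : R) :
  a < b -> continuous f' -> (forall y : R, is_derive y (1 : R) (f : R -> R^o) (f' y)) ->
  f a = 0 -> f b = 0 ->
  \int[@lebesgue_measure R]_(y in `[a, b]) f' y = 0.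
Proof.
move=> ab cf' df fa fb.
have cf : continuous f.
  move=> y; apply/differentiable_continuous/derivable1_diffP.
  by have [] := df y.
rewrite /Rintegral (@continuous_FTC2 _ f' f)// ?fa ?fb ?subee//.
- exact: continuous_subspaceT.
- split.
  + by move=> y _; have [] := df y.
  + exact/cvg_at_right_filter/cf.
  + exact/cvg_at_left_filter/cf.
- by move=> y _; rewrite derive1E; have [_ ->] := df y.
Qed.

Section ConeSubharmonic.
Context (R : realType).
Notation mu := (@lebesgue_measure R).
Variables (k : R) (v v1 v2 v11 v22 : R * R -> R).
Hypotheses (k0 : 0 < k)
  (cv : continuous v) (cv1 : continuous v1) (cv11 : continuous v11)
  (cv22 : continuous v22)
  (dv1 : forall x y : R,
    is_derive x (1 : R) (fun t : R => v (t, y) : R^o) (v1 (x, y)))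
  (dv11 : forall x y : R,
    is_derive x (1 : R) (fun t : R => v1 (t, y) : R^o) (v11 (x, y)))
  (dv22 : forall x y : R,
    is_derive y (1 : R) (fun t : R => v2 (x, t) : R^o) (v22 (x, y)))
  (v_cone : forall x y, k * x <= `|y| -> v (x, y) = 0)
  (v1_cone : forall x y, k * x <= `|y| -> v1 (x, y) = 0)
  (v2_cone : forall x y, k * x <= `|y| -> v2 (x, y) = 0)
  (v_ge0 : forall z, 0 <= v z)
  (v_sub : forall z, 0 <= v11 z + v22 z).

(** The derivative of the slice integral of [v1] is the integral of [v11]. It equals that of
    [v11 + v22], because [v2] vanishes at both ends of the window, and is nonnegative by
    subharmonicity. The slice integral is 0 at abscissa 0, where the vertical line misses the
    cone. *)
Lemma cone_slice_derive_ge0 (L x : R) : 0 < L -> 0 <= x -> k * x <= L ->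
  0 <= \int[mu]_(y in `[- L, L]) v1 (x, y).
Proof.
move=> L0 x0 kxL; pose D t : R^o := \int[mu]_(y in `[- L, L]) v1 (t, y).
have dD (t : R) : is_derive t (1 : R) D (\int[mu]_(y in `[- L, L]) v11 (t, y)).
  exact: is_derive_integral_param.
have D0 : D 0 = 0.
  rewrite /D /Rintegral integral0_eq//= => y _.
  by rewrite v1_cone// mulr0.
have iv (z : R) (f : R * R -> R) : continuous f ->
    mu.-integrable `[- L, L] (EFin \o (fun y : R => f (z, y))).
  by move=> cf; apply: continuous_integrable_itv; exact: (@continuous_slice2 _ f).
have dD_ge0 t : t <= x -> 0 <= (D^`())%classic t.
  move=> tx; rewrite derive1E; have [_ ->] := dD t.
  have ktL : k * t <= L by rewrite (le_trans _ kxL)// ler_pM2l.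
  have <- : \int[mu]_(y in `[- L, L]) (v11 (t, y) + v22 (t, y)) =
      \int[mu]_(y in `[- L, L]) v11 (t, y).
    rewrite RintegralD//; [|exact: iv|exact: iv].
    rewrite (@FTC2_vanishing_ends _ (fun y => v2 (t, y)))// ?addr0//.
    - by rewrite gtrN.
    - exact: (@continuous_slice2 _ v22).
    - by rewrite v2_cone// normrN ger0_norm// ltW.
    - by rewrite v2_cone// ger0_norm// ltW.
  by apply: Rintegral_ge0 => y _; exact: v_sub.
change (0 <= D x); rewrite -D0.
have cD : continuous D.
  move=> t; apply/differentiable_continuous/derivable1_diffP.
  by have [] := dD t.
apply: (@ger0_derive1_le_cc _ D 0 x).
- by move=> t _; have [] := dD t.
- by move=> t; rewrite in_itv/= => /andP[_ /ltW]; exact: dD_ge0.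
- exact: continuous_subspaceT.
- by rewrite in_itv/= lexx.
- by rewrite in_itv/= lexx andbT.
- by [].
Qed.

Lemma cone_slice_nondecreasing (L x1 x2 : R) : 0 < L ->
  0 <= x1 -> x1 <= x2 -> k * x2 <= L ->
  \int[mu]_(y in `[- L, L]) v (x1, y) <= \int[mu]_(y in `[- L, L]) v (x2, y).
Proof.
move=> L0 x10 x12 kxL; pose M t : R^o := \int[mu]_(y in `[- L, L]) v (t, y).
have dM (t : R) : is_derive t (1 : R) M (\int[mu]_(y in `[- L, L]) v1 (t, y)).
  exact: is_derive_integral_param.
have cM : continuous M.
  move=> t; apply/differentiable_continuous/derivable1_diffP.
  by have [] := dM t.
apply: (@ger0_derive1_le_cc _ M x1 x2).
- by move=> t _; have [] := dM t.
- move=> t; rewrite in_itv/= => /andP[/ltW x1t /ltW tx2].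
  rewrite derive1E; have [_ ->] := dM t.
  apply: cone_slice_derive_ge0 => //; first exact: le_trans x1t.
  by rewrite (le_trans _ kxL)// ler_pM2l.
- exact: continuous_subspaceT.
- by rewrite in_itv/= lexx.
- by rewrite in_itv/= lexx andbT.
- by [].
Qed.

(** The slice vanishes beyond [k * x], so slices at different abscissae can be compared on one
    window. *)
Lemma cone_slice_integralE (L x : R) : k * x <= L ->
  (\int[mu]_y (v (x, y))%:E = (\int[mu]_(y in `[- L, L]) v (x, y))%:E)%E.
Proof.
move=> kxL; rewrite /Rintegral fineK; last first.
  apply: integrable_fin_num => //.
  by apply: continuous_integrable_itv; exact: (@continuous_slice2 _ v).
rewrite [RHS]integral_mkcond; apply: eq_integral => y _.
rewrite patchE; case: ifPn => // /negP yL.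
rewrite v_cone// (le_trans kxL)// leNgt; apply/negP => yL'; apply: yL.
by rewrite inE/= in_itv/= -ler_norml ltW.
Qed.

Lemma cone_slice_integral_gt0 (x y : R) : 0 < v (x, y) ->
  (0 < \int[mu]_t (v (x, t))%:E)%E.
Proof.
move=> v0.
(* By continuity [v (x, _)] keeps at least half of its value on [[y, y + e / 2]], an interval of
   positive length. *)
have /cvgrPdist_lt/(_ (v (x, y) / 2)) := @continuous_slice2 _ v x cv y.
rewrite divr_gt0// => /(_ isT)[e /= e0 He].
have vge t : `[y, y + e / 2]%classic t -> v (x, y) / 2 <= v (x, t).
  rewrite /= in_itv/= => /andP[yt te].
  have := He t; rewrite /ball_ /= ltr_distl ltr_distl => /(_ _)/andP[].
    apply/andP; split; lra.
  move=> _; lra.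
have : (0 < \int[mu]_(t in `[y, (y + e / 2)%R]) ((v (x, y) / 2)%R)%:E)%E.
  rewrite integral_cst//= lebesgue_measure_itv/= lte_fin ltrDl divr_gt0//.
  by rewrite -EFinD -EFinM lte_fin mulr_gt0 ?divr_gt0//; lra.
move=> /lt_le_trans; apply.
have mv : measurable_fun setT (fun t : measurableTypeR R => (v (x, t))%:E).
  apply/measurable_EFinP; apply: continuous_measurable_fun.
  exact: (@continuous_slice2 _ v).
apply: (@le_trans _ _ (\int[mu]_(t in `[y, (y + e / 2)%R]) (v (x, t))%:E)%E).
  apply: ge0_le_integral => //.
  - by move=> t _; rewrite lee_fin divr_ge0// ltW.
  - exact: measurable_funS mv.
apply: ge0_subset_integral => //.
by move=> t _; rewrite lee_fin.
Qed.

Lemma cone_subharmonic_eq0 :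
  (area R).-integrable setT (EFin \o (v : plane R -> R)) ->
  forall z, v z = 0.
Proof.
move=> iv [x y]; apply/eqP; rewrite eq_le v_ge0 andbT leNgt; apply/negP => vxy.
have x0 : 0 < x.
  rewrite ltNge; apply/negP => x0; move: vxy; rewrite v_cone ?ltxx//.
  by rewrite (le_trans _ (normr_ge0 _))// mulr_ge0_le0// ltW.
have [mv fin] := integrableP _ _ _ iv.
pose m := (\int[mu]_t (v (x, t))%:E)%E.
have m0 : (0 < m)%E := cone_slice_integral_gt0 vxy.
have m_le t : x <= t -> (m <= \int[mu]_y (v (t, y))%:E)%E.
  move=> xt; have t0 : 0 < t by exact: lt_le_trans xt.
  have kxt : k * x <= k * t by rewrite ler_pM2l.
  (* The window of half-width [k * t] contains the slices at both [x] and [t]. *)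
  rewrite /m (cone_slice_integralE kxt) (cone_slice_integralE (lexx (k * t))).
  rewrite lee_fin; apply: cone_slice_nondecreasing => //; last exact: ltW.
  exact: mulr_gt0.
clearbody m; move: fin; apply/negP; rewrite -leNgt.
under eq_integral do rewrite /= ger0_norm//.
rewrite /area fubini_tonelli1//=.
(* By Tonelli the integral of [v] is at least that of the constant [m > 0] over a half-line, which
   is infinite. *)
apply: (@le_trans _ _ (\int[mu]_(t in `[x, +oo[) m)%E).
  rewrite integral_cst//= lebesgue_measure_itv/= ltry.
  by rewrite addye// gt0_muley.
have mF : measurable_fun setT (fun t : measurableTypeR R => \int[mu]_y (v (t, y))%:E)%E.
  exact: (@measurable_fun_fubini_tonelli_F _ _ (measurableTypeR R)
    (measurableTypeR R) R mu (EFin \o (v : plane R -> R))).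
apply: (@le_trans _ _ (\int[mu]_(t in `[x, +oo[) \int[mu]_y (v (t, y))%:E)%E).
  apply: ge0_le_integral => //.
  - by move=> t _; exact: ltW.
  - exact: measurable_funS mF.
  - by move=> t /=; rewrite in_itv/= andbT; exact: m_le.
apply: ge0_subset_integral => //.
by move=> t _; apply: integral_ge0 => u _; rewrite lee_fin.
Qed.

End ConeSubharmonic.

(** * The cutoff function *)

Lemma is_derive_cvgP (R : numFieldType) (V W : normedModType R) (f : V -> W)
    (a v : V) (d : W) :
  is_derive a v f d <->
  h^-1 *: (f (h *: v + a) - f a) @[h --> 0^'] --> d.
Proof.
split=> [[df <-] //|fd]; apply: DeriveDef; first by apply/cvg_ex; exists d.
exact/cvg_lim.
Qed.

Lemma is_derive_continuous (R : realType) (f df : R -> R) :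
  (forall s : R, is_derive s (1 : R) (f : R -> R^o) (df s)) -> continuous f.
Proof.
move=> fdf s; apply/differentiable_continuous/derivable1_diffP.
by have [] := fdf s.
Qed.

(** When [f 0 = 0] this is [f] composed with the positive part. *)
Definition pospart_comp (R : realType) (f : R -> R) (s : R) : R :=
  if 0 < s then f s else 0.

Lemma is_derive_pospart_comp (R : realType) (f df : R -> R) :
  f 0 = 0 -> df 0 = 0 ->
  (forall s : R, 0 <= s -> is_derive s (1 : R) (f : R -> R^o) (df s)) ->
  forall s : R, is_derive s (1 : R) (pospart_comp f : R -> R^o)
    (pospart_comp df s).
Proof.
move=> f0 df0 fdf s; rewrite /pospart_comp; case: (ltgtP s 0) => [s0|s0|->].
- apply: (@near_eq_is_derive _ _ _ (cst 0 : R -> R^o)).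
  have : \forall t \near s, t < 0 by exact: lt_nbhsl.
  by apply: filterS => t t0; rewrite ltNge (ltW t0).
- apply: (@near_eq_is_derive _ _ _ f); last exact/fdf/ltW.
  have : \forall t \near s, 0 < t by exact: lt_nbhsr.
  by apply: filterS => t ->.
(* At 0 each difference quotient of the truncation is either that of [f] or 0, so it tends to 0
   along with that of [f]. *)
- have /is_derive_cvgP := fdf 0 (lexx 0).
  rewrite df0 => /cvgrPdist_lt fd; apply/is_derive_cvgP/cvgrPdist_lt => e e0.
  have := fd e e0; apply: filterS => h; rewrite /= ltxx f0 !subr0 !sub0r !normrN.
  rewrite addr0 /GRing.scale /= mulr1.
  by case: ifPn => // _ _; rewrite mulr0 normr0.
Qed.

Lemma continuous_pospart_comp (R : realType) (f : R -> R) :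
  f 0 = 0 -> (forall s : R, 0 <= s -> {for s, continuous f}) ->
  continuous (pospart_comp f).
Proof.
move=> f0 cf s; rewrite /continuous_at /pospart_comp; case: (ltgtP s 0) => [s0|s0|->].
- apply: cvg_near_cst.
  have : \forall t \near s, t < 0 by exact: lt_nbhsl.
  by apply: filterS => t t0; rewrite ltNge (ltW t0).
- apply: cvg_trans (cf s (ltW s0)); apply: near_eq_cvg.
  have : \forall t \near s, 0 < t by exact: lt_nbhsr.
  by apply: filterS => t ->.
- apply/cvgrPdist_lt => e e0.
  have /cvgrPdist_lt/(_ e e0) := cf 0 (lexx 0).
  apply: filterS => t; rewrite f0 !sub0r !normrN.
  by case: ifPn => // _ _; rewrite normr0.
Qed.

(* On the positive reals eta1 and eta2 are the first two derivatives of
   eta s = s^3 / (1 + s)^2, whose growth is linear so that eta (g - e) inherits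
   the integrability of g. *)
Definition eta (R : realType) : R -> R :=
  pospart_comp (fun s => s ^+ 3 * (1 + s) ^- 2).
Definition eta1 (R : realType) : R -> R :=
  pospart_comp (fun s => (3 * s ^+ 2 + s ^+ 3) * (1 + s) ^- 3).
Definition eta2 (R : realType) : R -> R :=
  pospart_comp (fun s => 6 * s * (1 + s) ^- 4).

Lemma eta_eq0 (R : realType) (s : R) : s <= 0 -> eta s = 0.
Proof. by rewrite /eta /pospart_comp ltNge => ->. Qed.

Lemma eta1_eq0 (R : realType) (s : R) : s <= 0 -> eta1 s = 0.
Proof. by rewrite /eta1 /pospart_comp ltNge => ->. Qed.

Lemma eta2_eq0 (R : realType) (s : R) : s <= 0 -> eta2 s = 0.
Proof. by rewrite /eta2 /pospart_comp ltNge => ->. Qed.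

Lemma eta_gt0 (R : realType) (s : R) : 0 < s -> 0 < eta s.
Proof.
move=> s0; rewrite /eta /pospart_comp s0 divr_gt0 ?exprn_gt0//.
by rewrite addr_gt0.
Qed.

Lemma eta_ge0 (R : realType) (s : R) : 0 <= eta s.
Proof. by have [/eta_eq0->//|/eta_gt0/ltW] := lerP s 0. Qed.

Lemma eta2_ge0 (R : realType) (s : R) : 0 <= eta2 s.
Proof.
rewrite /eta2 /pospart_comp; case: ifPn => // s0.
by rewrite divr_ge0 ?exprn_ge0 ?mulr_ge0 ?addr_ge0// ltW.
Qed.

(** Holds since [s ^+ 2 <= (1 + s) ^+ 2] for [s > 0]. With [s = g - e] and [t = g] it bounds the
    cutoff by the absolute value of [g]. *)
Lemma eta_le_norm (R : realType) (s t : R) : s <= `|t| -> eta s <= `|t|.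
Proof.
rewrite /eta /pospart_comp; case: ifPn => // s0 st; apply: le_trans st.
rewrite ler_pdivrMr ?exprn_gt0 ?addr_gt0// exprS ler_wpM2l ?ltW//.
by rewrite ltrXn2r// ?ltW ?addr_gt0// ltrDr.
Qed.

(** One quotient rule serves [eta], [eta1] and [eta2], whose denominators are all powers of
    [1 + s]. *)
Lemma is_derive_div_onep (R : realType) (p : R -> R) (n : nat) (t dp : R) :
  1 + t != 0 -> is_derive t (1 : R) (p : R -> R^o) dp ->
  is_derive t (1 : R) ((fun s : R => p s * (1 + s) ^- n.+1) : R -> R^o)
    (dp * (1 + t) ^- n.+1 - n.+1%:R * p t * (1 + t) ^- n.+2).
Proof.
move=> t1 dp_t.
have d1 : is_derive t (1 : R) ((fun s : R => 1 + s) : R -> R^o) (0 + 1).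
  exact: (is_deriveD (is_derive_cst (1 : R^o) t 1) (is_derive_id (t : R^o) 1)).
have dX : is_derive t (1 : R) ((fun s : R => (1 + s) ^+ n.+1) : R -> R^o)
    ((n.+1%:R * (1 + t) ^+ n) *: (0 + 1)).
  by have := is_deriveX n.+1 d1; rewrite exprfctE.
have dV := @is_deriveV _ (fun s : R => (1 + s) ^+ n.+1) t _ _
  (expf_neq0 n.+1 t1) dX.
apply: is_derive_eq (is_deriveM dp_t dV) _.
have := expf_neq0 n t1; rewrite /GRing.scale/= !exprS.
by move: (1 + t) t1 ((1 + t) ^+ n) => u u0 w w0; field; rewrite w0 u0.
Qed.

Lemma is_derive_eta (R : realType) (s : R) :
  is_derive s (1 : R) (@eta R : R -> R^o) (eta1 s).
Proof.
apply: is_derive_pospart_comp.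
- by rewrite expr0n mul0r.
- by rewrite !expr0n mulr0 addr0 mul0r.
move=> t t0; have t1 : 1 + t != 0 by rewrite gt_eqF// ltr_wpDr.
have dp := @is_deriveX _ _ (id : R -> R^o) 3 t 1 _ (is_derive_id (t : R^o) 1).
have := is_derive_div_onep 1 t1 dp; rewrite !exprfctE => /is_derive_eq; apply.
by rewrite /GRing.scale/= ?fctE /GRing.scale/=; field.
Qed.

Lemma is_derive_eta1 (R : realType) (s : R) :
  is_derive s (1 : R) (@eta1 R : R -> R^o) (eta2 s).
Proof.
apply: is_derive_pospart_comp.
- by rewrite !expr0n mulr0 addr0 mul0r.
- by rewrite mulr0 mul0r.
move=> t t0; have t1 : 1 + t != 0 by rewrite gt_eqF// ltr_wpDr.
have dp2 := @is_deriveX _ _ (id : R -> R^o) 2 t 1 _ (is_derive_id (t : R^o) 1).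
have dp3 := @is_deriveX _ _ (id : R -> R^o) 3 t 1 _ (is_derive_id (t : R^o) 1).
have dp := is_deriveD (is_deriveZ 3 dp2) dp3.
have := is_derive_div_onep 2 t1 dp; rewrite !fctE => /is_derive_eq; apply.
by rewrite /GRing.scale/= ?fctE /GRing.scale/=; field.
Qed.

Lemma continuous_eta (R : realType) : continuous (@eta R).
Proof. exact: is_derive_continuous (@is_derive_eta R). Qed.

Lemma continuous_eta1 (R : realType) : continuous (@eta1 R).
Proof. exact: is_derive_continuous (@is_derive_eta1 R). Qed.

Lemma continuous_eta2 (R : realType) : continuous (@eta2 R).
Proof.
apply: continuous_pospart_comp; first by rewrite mulr0 mul0r.
move=> t t0; have t1 : 1 + t != 0 by rewrite gt_eqF// ltr_wpDr.
have dp : is_derive t (1 : R) ((fun s : R => 6 * s) : R -> R^o) (6 *: 1).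
  exact: is_deriveZ.
apply/differentiable_continuous/derivable1_diffP.
by have [] := is_derive_div_onep 3 t1 dp.
Qed.

(** * Functions of class C^1 on the plane *)

Notation dir1 R := ((1, 0) : R * R).
Notation dir2 R := ((0, 1) : R * R).

(** Reduces a directional derivative to one real variable, where the one-variable chain rule is
    available. *)
Lemma is_derive_lineP (R : realType) (V W : normedModType R) (f : V -> W)
    (a v : V) (d : W) :
  is_derive a v f d <->
  is_derive (0 : R) (1 : R) (fun t : R => f (t *: v + a)) d.
Proof.
rewrite !is_derive_cvgP.
by under [in X in _ <-> X]eq_fun do rewrite addr0 scale0r add0r [_%:A]mulr1.
Qed.

Lemma is_derive_slice1 (R : realType) (f : R * R -> R) (x y d : R) :
  is_derive (x, y) (dir1 R) (f : R * R -> R^o) d <->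
  is_derive x (1 : R) (fun t : R => f (t, y) : R^o) d.
Proof.
rewrite !is_derive_cvgP; have -> // : (fun h : R => h^-1 *:
    ((f (h *: dir1 R + (x, y)) : R^o) - f (x, y))) =
  (fun h : R => h^-1 *: ((f (h *: (1 : R) + x, y) : R^o) - f (x, y))).
apply/funext => h; congr (_ *: (f _ - _)).
by apply: (congr1 (pair _)); rewrite [LHS]/= scaler0 add0r.
Qed.

Lemma is_derive_slice2 (R : realType) (f : R * R -> R) (x y d : R) :
  is_derive (x, y) (dir2 R) (f : R * R -> R^o) d <->
  is_derive y (1 : R) (fun t : R => f (x, t) : R^o) d.
Proof.
rewrite !is_derive_cvgP; have -> // : (fun h : R => h^-1 *:
    ((f (h *: dir2 R + (x, y)) : R^o) - f (x, y))) =
  (fun h : R => h^-1 *: ((f (x, h *: (1 : R) + y) : R^o) - f (x, y))).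
apply/funext => h; congr (_ *: (f _ - _)).
by apply: (congr1 (pair^~ _)); rewrite [LHS]/= scaler0 add0r.
Qed.

Lemma is_derive_comp_dir (R : realType) (V : normedModType R) (g : V -> R)
    (phi : R -> R) (a v : V) (dg dphi : R) :
  is_derive a v (g : V -> R^o) dg ->
  is_derive (g a) (1 : R) (phi : R -> R^o) dphi ->
  is_derive a v ((phi \o g) : V -> R^o) (dphi * dg).
Proof.
move=> /is_derive_lineP dg_a dphi_a; apply/is_derive_lineP.
apply: (@is_derive1_comp _ phi (fun t : R => g (t *: v + a))) => //.
by rewrite scale0r add0r.
Qed.

(** By the mean value theorem the increment is [df c * k] with [c] between [x] and [x + k], and
    [df c] is within [e] of [d]. *)
Lemma taylor1_le (R : realType) (f df : R -> R) (x k d e : R) :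
  (forall s : R, `|s - x| <= `|k| ->
    is_derive s (1 : R) (f : R -> R^o) (df s)) ->
  (forall s, `|s - x| <= `|k| -> `|df s - d| <= e) ->
  `|f (x + k) - f x - k * d| <= e * `|k|.
Proof.
move=> fdf dfd; suff [c ck ->] : exists2 c, `|c - x| <= `|k| &
    f (x + k) - f x = df c * k.
  by rewrite [k * d]mulrC -mulrBl normrM ler_wpM2r// dfd.
have cf s : `|s - x| <= `|k| -> {for s, continuous f}.
  move=> sk; apply/differentiable_continuous/derivable1_diffP.
  by have [] := fdf s sk.
(* The mean value theorem asks for ordered end points, hence the split on the sign of [k]. *)
have [k0|k0] := lerP 0 k.
- have near_x c : c \in `[x, x + k] -> `|c - x| <= `|k|.
    by rewrite in_itv/= => /andP[? ?]; rewrite !ger0_norm; lra.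
  have [|||c ck ->] := @MVT_segment _ f df x (x + k).
  + by rewrite lerDl.
  + by move=> s /subset_itv_oo_cc/near_x; exact: fdf.
  + apply: continuous_in_subspaceT => s; rewrite inE/= => /near_x; exact: cf.
  + by exists c; [exact: near_x|congr (_ * _); lra].
- have near_x c : c \in `[x + k, x] -> `|c - x| <= `|k|.
    by rewrite in_itv/= => /andP[? ?]; rewrite !ler0_norm; lra.
  have [|||c ck E] := @MVT_segment _ f df (x + k) x.
  + by rewrite gerDl ltW.
  + by move=> s /subset_itv_oo_cc/near_x; exact: fdf.
  + apply: continuous_in_subspaceT => s; rewrite inE/= => /near_x; exact: cf.
  + by exists c; [exact: near_x|move: E; lra].
Qed.

(** The partial derivatives are carried as named functions, so that the chain rule yields explicit
    formulas. *)
Definition C1data (R : realType) (U : set (R * R)) (h h1 h2 : R * R -> R) :=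
  forall z, U z -> [/\ is_derive z (dir1 R) (h : R * R -> R^o) (h1 z),
    is_derive z (dir2 R) (h : R * R -> R^o) (h2 z),
    {for z, continuous h1} & {for z, continuous h2}].

Section C1.
Context (R : realType) (U : set (R * R)) (h h1 h2 : R * R -> R).
Hypotheses (oU : open U) (hC1 : C1data U h h1 h2).

(** Total differentiability: the displacement is split into a vertical and a horizontal step, and
    [taylor1_le] handles each. Continuity of the gradient at [z] makes the error uniform in both
    increments. *)
Lemma C1data_taylor (z : R * R) (e : R) : U z -> 0 < e ->
  \forall d \near 0^'+, forall k1 k2, `|k1| < d -> `|k2| < d ->
    `|h (z.1 + k1, z.2 + k2) - h z - (k1 * h1 z + k2 * h2 z)|
      <= e * (`|k1| + `|k2|).
Proof.
move=> Uz e0; have [_ _ /cvgrPdist_le/(_ e e0) ch1 /cvgrPdist_le/(_ e e0) ch2] :=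
  hC1 Uz.
have : \forall w \near z, [/\ U w, `|h1 w - h1 z| <= e & `|h2 w - h2 z| <= e].
  near=> w; split.
  - by near: w; exact: open_nbhs_nbhs.
  - by rewrite distrC; near: w.
  - by rewrite distrC; near: w.
move=> /nbhs_ballP[r /= r0 Hr]; near=> d => k1 k2 k1d k2d.
have {}Hr a b : `|a - z.1| <= `|k1| -> `|b - z.2| <= `|k2| ->
    [/\ U (a, b), `|h1 (a, b) - h1 z| <= e & `|h2 (a, b) - h2 z| <= e].
  have dr : d < r by near: d; exact: nbhs_right_lt.
  move=> ak bk; apply: Hr; split; rewrite /= /ball/= distrC.
    by rewrite (le_lt_trans ak)// (lt_trans k1d).
  by rewrite (le_lt_trans bk)// (lt_trans k2d).
have z1 : `|z.1 - z.1| <= `|k1| by rewrite subrr normr0.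
have z2 : `|z.2 + k2 - z.2| <= `|k2| by rewrite addrAC subrr add0r.
(* The horizontal step runs at height [z.2 + k2]; its derivative is still within [e] of [h1 z]. *)
have T1 : `|h (z.1 + k1, z.2 + k2) - h (z.1, z.2 + k2) - k1 * h1 z| <= e * `|k1|.
  apply: (@taylor1_le _ (fun s => h (s, z.2 + k2)) (fun s => h1 (s, z.2 + k2))).
    move=> s sk; have [/hC1[+ _ _ _] _ _] := Hr s (z.2 + k2) sk z2.
    by move=> /is_derive_slice1.
  by move=> s sk; have [] := Hr s (z.2 + k2) sk z2.
have T2 : `|h (z.1, z.2 + k2) - h (z.1, z.2) - k2 * h2 z| <= e * `|k2|.
  apply: (@taylor1_le _ (fun s => h (z.1, s)) (fun s => h2 (z.1, s))).
    move=> s sk; have [/hC1[_ + _ _] _ _] := Hr z.1 s z1 sk.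
    by move=> /is_derive_slice2.
  by move=> s sk; have [] := Hr z.1 s z1 sk.
rewrite -surjective_pairing in T2.
rewrite mulrDr; apply: le_trans (lerD T1 T2); apply: le_trans (ler_normD _ _).
by rewrite le_eqVlt; apply/orP; left; apply/eqP; congr `| _ |; ring.
Unshelve. all: by end_near. Qed.

Lemma C1data_continuous (z : R * R) : U z -> {for z, continuous h}.
Proof.
move=> Uz; apply/cvgrPdist_lt => e e0.
(* For increments below [d] the Taylor estimate with constant 1 bounds the change of [h] by [d * M]:
   the 2 comes from the error term, the rest from the gradient. *)
pose M := 2 + `|h1 z| + `|h2 z|.
have M0 : 0 < M by rewrite /M; have := normr_ge0 (h1 z); have := normr_ge0 (h2 z); lra.
have [d [d0 dM T]] : exists d, [/\ 0 < d, d < e / M & forall k1 k2,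
    `|k1| < d -> `|k2| < d ->
    `|h (z.1 + k1, z.2 + k2) - h z - (k1 * h1 z + k2 * h2 z)|
      <= 1 * (`|k1| + `|k2|)].
  near (0 : R)^'+ => d; exists d; split.
  - by near: d; exact: nbhs_right_gt.
  - by near: d; apply: nbhs_right_lt; rewrite divr_gt0.
  - by near: d; exact: C1data_taylor.
apply: (nbhs_ballP z _).2; exists d => //= w [/=]; rewrite /ball/= => w1 w2.
rewrite distrC in w1; rewrite distrC in w2.
have := T (w.1 - z.1) (w.2 - z.2) w1 w2; rewrite ![_ + (_ - _)]addrC !subrK -surjective_pairing => H.
have b1 : `|(w.1 - z.1) * h1 z| <= d * `|h1 z|.
  by rewrite normrM ler_wpM2r// ltW.
have b2 : `|(w.2 - z.2) * h2 z| <= d * `|h2 z|.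
  by rewrite normrM ler_wpM2r// ltW.
move: dM; rewrite ltr_pdivlMr// => dM.
have -> : h z - h w = - ((h w - h z - ((w.1 - z.1) * h1 z + (w.2 - z.2) * h2 z))
   + ((w.1 - z.1) * h1 z + (w.2 - z.2) * h2 z)) by ring.
rewrite normrN (le_lt_trans (ler_normD _ _))//.
rewrite (le_lt_trans (lerD H (ler_normD _ _)))//.
apply: le_lt_trans dM; rewrite /M.
by move: w1 w2 b1 b2; lra.
Unshelve. all: by end_near. Qed.

(** Oblique directions matter because an isometry sends the coordinate directions to arbitrary unit
    vectors. The formula is the Taylor estimate along [t *: v]. *)
Lemma C1data_is_derive (z v : R * R) : U z ->
  is_derive z v (h : R * R -> R^o) (v.1 * h1 z + v.2 * h2 z).
Proof.
move=> Uz; apply/is_derive_cvgP/cvgrPdist_le => e e0.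
(* The summand 1 keeps [M] positive when [v = 0]; the relative error [e / M] then contributes at
   most [e] along [v]. *)
pose M := 1 + `|v.1| + `|v.2|.
have M0 : 0 < M by rewrite /M; have := normr_ge0 v.1; have := normr_ge0 v.2; lra.
have eM : 0 < e / M by rewrite divr_gt0.
have [d [d0 T]] : exists d, 0 < d /\ forall k1 k2,
    `|k1| < d -> `|k2| < d ->
    `|h (z.1 + k1, z.2 + k2) - h z - (k1 * h1 z + k2 * h2 z)|
      <= e / M * (`|k1| + `|k2|).
  near (0 : R)^'+ => d; exists d; split.
  - by near: d; exact: nbhs_right_gt.
  - by near: d; exact: C1data_taylor.
near=> t.
have t0 : t != 0 by near: t; exact: nbhs_dnbhs_neq.
have tM : `|t| * M < d.
  rewrite -ltr_pdivlMr//; near: t; apply: dnbhs0_lt.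
  by rewrite divr_gt0.
have k1 : `|t * v.1| < d.
  apply: le_lt_trans tM; rewrite normrM ler_wpM2l//.
  by rewrite /M; have := normr_ge0 v.2; lra.
have k2 : `|t * v.2| < d.
  apply: le_lt_trans tM; rewrite normrM ler_wpM2l//.
  by rewrite /M; have := normr_ge0 v.1; lra.
have {T} := T _ _ k1 k2.
have -> : (z.1 + t * v.1, z.2 + t * v.2) = t *: v + z.
  by rewrite [RHS]addrC [RHS]surjective_pairing.
have -> : v.1 * h1 z + v.2 * h2 z - t^-1 *: ((h (t *: v + z) : R^o) - h z) =
    - (t^-1 * (h (t *: v + z) - h z - (t * v.1 * h1 z + t * v.2 * h2 z))).
  by rewrite /GRing.scale/=; field.
move=> T; rewrite normrN normrM normfV mulrC ler_pdivrMr ?normr_gt0//.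
apply: (le_trans T).
have abM : (`|v.1| + `|v.2|) / M <= 1.
  by rewrite ler_pdivrMr// mul1r /M; lra.
rewrite !normrM -mulrDr (_ : _ * _ = e * `|t| * ((`|v.1| + `|v.2|) / M)).
  by rewrite ler_piMr// mulr_ge0// ltW.
by ring.
Unshelve. all: by end_near. Qed.

End C1.

(** * Uniqueness of integrable harmonic functions on a cone *)

Definition ext0 (R : realType) (U : set (R * R)) (f : R * R -> R) (z : R * R) : R :=
  if z \in U then f z else 0.

Lemma ext0_in (R : realType) (U : set (R * R)) (f : R * R -> R) z :
  U z -> ext0 U f z = f z.
Proof. by move=> Uz; rewrite /ext0 mem_set. Qed.

Lemma ext0_out (R : realType) (U : set (R * R)) (f : R * R -> R) z :
  ~ U z -> ext0 U f z = 0.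
Proof. by move=> Uz; rewrite /ext0 memNset. Qed.

Section Extension.
Context (R : realType) (U : set (R * R)) (f : R * R -> R).
Hypotheses (oU : open U)
  (f0 : forall z, ~ U z -> \forall w \near z, U w -> f w = 0).

Lemma near_ext0_in z : U z -> \forall w \near z, f w = ext0 U f w.
Proof.
move=> Uz; have : \forall w \near z, U w by exact: open_nbhs_nbhs.
by apply: filterS => w Uw; rewrite ext0_in.
Qed.

(** By [f0] the extension is locally 0 at the boundary of [U], so no matching of derivatives has to
    be checked there. *)
Lemma near_ext0_out z : ~ U z -> \forall w \near z, 0 = ext0 U f w.
Proof.
move=> /f0; apply: filterS => w fw; have [Uw|Uw] := pselect (U w).
  by rewrite ext0_in// fw.
by rewrite ext0_out.
Qed.

Lemma is_derive_ext0 (df : R * R -> R) (v : R * R) :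
  (forall z, U z -> is_derive z v (f : R * R -> R^o) (df z)) ->
  forall z, is_derive z v (ext0 U f : R * R -> R^o) (ext0 U df z).
Proof.
move=> fdf z; have [Uz|Uz] := pselect (U z).
  rewrite ext0_in//; apply: near_eq_is_derive (fdf z Uz).
  exact: near_ext0_in.
rewrite ext0_out//; apply: near_eq_is_derive (near_ext0_out Uz) _.
Qed.

Lemma continuous_ext0 :
  (forall z, U z -> {for z, continuous f}) -> continuous (ext0 U f).
Proof.
move=> cf z; have [Uz|Uz] := pselect (U z); rewrite /continuous_at.
  rewrite ext0_in//; apply: cvg_trans (cf z Uz); apply: near_eq_cvg.
  exact: near_ext0_in.
rewrite ext0_out//; apply: cvg_near_cst.
by apply: filterS (near_ext0_out Uz).
Qed.

End Extension.

(** For [k = Num.sqrt 3] this is the sector of half-opening pi / 3 around the positive first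
    axis. *)
Definition cone (R : realType) (k : R) : set (R * R) :=
  [set z | `|z.2| < k * z.1].

Lemma open_cone (R : realType) (k : R) : open (cone k).
Proof.
have -> : cone k = (fun z : R * R => k * z.1 - `|z.2|) @^-1` [set x | 0 < x].
  by apply/seteqP; split=> z; rewrite /cone/= subr_gt0.
apply: open_comp; last exact: open_gt.
move=> z _; apply: cvgB; first by apply: cvgMr; exact: cvg_fst.
by apply: cvg_norm; exact: cvg_snd.
Qed.

Lemma measurable_cone (R : realType) (k : R) :
  measurable (cone k : set (plane R)).
Proof.
have mf : measurable_fun setT (fun z : plane R => k * z.1 - `|z.2|).
  apply: measurable_funB.
    by apply: measurable_funM => //; exact: measurable_fst.
  by apply: measurableT_comp => //; exact: measurable_snd.
have := mf measurableT `]0, +oo[%classic (measurable_itv _).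
rewrite setTI; congr measurable; apply/seteqP; split=> z /=;
  by rewrite in_itv/= andbT subr_gt0.
Qed.

(** The derivatives are given as functions, so that cutoffs can multiply them and [ext0] can extend
    them. *)
Definition regular_harmonic (R : realType) (U : set (R * R))
    (g : R * R -> R) : Prop :=
  exists g1 g2 g11 g22 : R * R -> R, forall z, U z ->
    [/\ [/\ is_derive z (dir1 R) (g : R * R -> R^o) (g1 z),
            is_derive z (dir2 R) (g : R * R -> R^o) (g2 z),
            is_derive z (dir1 R) (g1 : R * R -> R^o) (g11 z) &
            is_derive z (dir2 R) (g2 : R * R -> R^o) (g22 z)],
        [/\ {for z, continuous g}, {for z, continuous g1},
            {for z, continuous g2}, {for z, continuous g11} &
            {for z, continuous g22}] &
        g11 z + g22 z = 0].

Lemma is_derive_comp_sub (R : realType) (V : normedModType R)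
    (g : V -> R) (phi dphi : R -> R) (e : R) (a v : V) (dg : R) :
  (forall s : R, is_derive s (1 : R) (phi : R -> R^o) (dphi s)) ->
  is_derive a v (g : V -> R^o) dg ->
  is_derive a v ((fun z => phi (g z - e)) : V -> R^o) (dphi (g a - e) * dg).
Proof.
move=> phid dga; have dB : is_derive a v ((fun z => g z - e) : V -> R^o) dg.
  have := is_deriveB dga (is_derive_cst (e : R^o) a v); rewrite subr0.
  exact.
exact: (is_derive_comp_dir dB (phid (g a - e))).
Qed.

Lemma continuous_comp_sub (R : realType) (T : topologicalType) (g : T -> R)
    (phi : R -> R) (e : R) (z : T) :
  continuous phi -> {for z, continuous g} ->
  {for z, continuous (fun w => phi (g w - e))}.
Proof.
move=> cphi cg; apply: (@continuous_comp _ _ _ (fun w => g w - e) phi).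
  by apply: cvgB => //; exact: cvg_cst.
exact: cphi.
Qed.

Section ConeUniqueness.
Context (R : realType) (k : R) (g : R * R -> R).
Local Notation U := (cone k).
Hypotheses (k0 : 0 < k) (hg : regular_harmonic U g)
  (g_boundary : forall z, ~ U z -> forall e, 0 < e ->
    \forall w \near z, U w -> `|g w| < e)
  (ig : (area R).-integrable U (EFin \o (g : plane R -> R))).

(** A maximum principle in which integrability replaces control at infinity: [cone_subharmonic_eq0]
    forces the extended cutoff of [g] to be 0, yet it is positive wherever [g] exceeds [e]. *)
Lemma cone_harmonic_le0 z : U z -> g z <= 0.
Proof.
move=> Uz; rewrite leNgt; apply/negP => gz0.
have [g1 [g2 [g11 [g22 G]]]] := hg.
(* Half of [g z] is positive, as the boundary condition demands, and still leaves [g z - e > 0]. *)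
pose e := g z / 2.
have e0 : 0 < e by rewrite divr_gt0.
(* Each function to be extended is built from terms with a cutoff factor that is 0 on the
   nonpositive reals, so it vanishes on the part of the cone near any outside point. *)
have near0 (phi : R -> R) (c : R * R -> R) : (forall s, s <= 0 -> phi s = 0) ->
    forall w, ~ U w -> \forall u \near w, U u -> phi (g u - e) * c u = 0.
  move=> phi0 w /g_boundary/(_ e e0); apply: filterS => u /[apply] gu.
  by rewrite phi0 ?mul0r// subr_le0 (le_trans (ler_norm _))// ltW.
pose v := ext0 U (fun z => eta (g z - e)).
(* The derivatives of [eta (g - e)] inside the cone, by the chain and product rules. *)
pose w1 z := eta1 (g z - e) * g1 z.
pose w2 z := eta1 (g z - e) * g2 z.
pose w11 z := eta1 (g z - e) * g11 z + g1 z * (eta2 (g z - e) * g1 z).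
pose w22 z := eta1 (g z - e) * g22 z + g2 z * (eta2 (g z - e) * g2 z).
have near_v w : ~ U w -> \forall u \near w, U u -> eta (g u - e) = 0.
  move=> Uw; have := near0 _ (cst 1) (@eta_eq0 R) w Uw.
  by apply: filterS => u /[apply]; rewrite mulr1.
have near_w2nd c c' w : ~ U w -> \forall u \near w, U u ->
    eta1 (g u - e) * c u + c' u * (eta2 (g u - e) * c' u) = 0.
  move=> Uw; have := near0 _ (fun u => c' u * c' u) (@eta2_eq0 R) w Uw.
  have := near0 _ c (@eta1_eq0 R) w Uw.
  apply: filterS2 => u + + Uu => /(_ Uu)-> /(_ Uu) E.
  by rewrite add0r mulrCA.
have dw1 u : U u -> is_derive u (dir1 R) (w1 : R * R -> R^o) (w11 u).
  move=> /G[[d1 d2 d11 d22] _ _].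
  exact: (is_deriveM (is_derive_comp_sub e (@is_derive_eta1 R) d1) d11).
have dw2 u : U u -> is_derive u (dir2 R) (w2 : R * R -> R^o) (w22 u).
  move=> /G[[d1 d2 d11 d22] _ _].
  exact: (is_deriveM (is_derive_comp_sub e (@is_derive_eta1 R) d2) d22).
have oU := @open_cone R k.
have v0 : forall z, v z = 0.
  apply: (@cone_subharmonic_eq0 R k v (ext0 U w1) (ext0 U w2) (ext0 U w11)
    (ext0 U w22) k0).
  - apply: continuous_ext0 => // u /G[_ [cg _ _ _ _] _].
    by apply: continuous_comp_sub => //; exact: continuous_eta.
  - apply: continuous_ext0 => //; first exact: (near0 _ g1 (@eta1_eq0 R)).
    move=> u /G[_ [cg cg1 _ _ _] _]; apply: cvgM => //.
    by apply: continuous_comp_sub => //; exact: continuous_eta1.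
  - apply: continuous_ext0 => //; first exact: near_w2nd.
    move=> u /G[_ [cg cg1 _ cg11 _] _].
    by apply: cvgD; apply: cvgM => //; last apply: cvgM => //;
      apply: continuous_comp_sub => //;
      [exact: continuous_eta1|exact: continuous_eta2].
  - apply: continuous_ext0 => //; first exact: near_w2nd.
    move=> u /G[_ [cg _ cg2 _ cg22] _].
    by apply: cvgD; apply: cvgM => //; last apply: cvgM => //;
      apply: continuous_comp_sub => //;
      [exact: continuous_eta1|exact: continuous_eta2].
  - move=> x y; apply/is_derive_slice1; apply: is_derive_ext0 => //.
    move=> u /G[[d1 _ _ _] _ _].
    exact: (is_derive_comp_sub e (@is_derive_eta R)).
  - move=> x y; apply/is_derive_slice1; apply: is_derive_ext0 => //.
    exact: (near0 _ g1 (@eta1_eq0 R)).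
  - move=> x y; apply/is_derive_slice2; apply: is_derive_ext0 => //.
    exact: (near0 _ g2 (@eta1_eq0 R)).
  - by move=> x y xy; apply: ext0_out; rewrite /cone/=; apply/negP; rewrite -leNgt.
  - by move=> x y xy; apply: ext0_out; rewrite /cone/=; apply/negP; rewrite -leNgt.
  - by move=> x y xy; apply: ext0_out; rewrite /cone/=; apply/negP; rewrite -leNgt.
  - by move=> u; rewrite /v /ext0; case: ifPn => // _; exact: eta_ge0.
  - move=> u; rewrite /ext0; case: ifPn => [|_]; last by rewrite addr0.
    rewrite inE => /G[_ _ lap].
    (* The Laplacian of the cutoff: the first term vanishes because [g] is harmonic, and the second
       is nonnegative because [eta] is convex. *)
    have -> : w11 u + w22 u = eta1 (g u - e) * (g11 u + g22 u) +
      eta2 (g u - e) * (g1 u ^+ 2 + g2 u ^+ 2) by rewrite /w11 /w22; ring.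
    by rewrite lap mulr0 add0r mulr_ge0 ?eta2_ge0 ?addr_ge0 ?sqr_ge0.
  - have [mg _] := integrableP _ _ _ ig.
    have iv : (area R).-integrable U (EFin \o ((fun z => eta (g z - e)) : plane R -> R)).
      apply: le_integrable ig => //; first exact: measurable_cone.
        apply/measurable_EFinP; apply: measurableT_comp.
          by apply: continuous_measurable_fun; exact: continuous_eta.
        by apply: measurable_funB => //; exact/measurable_EFinP.
      move=> u _ /=; rewrite lee_fin ger0_norm ?eta_ge0// eta_le_norm//.
      by rewrite (le_trans _ (ler_norm _))// gerBl ltW.
    have := (integrable_mkcond _ (measurable_cone k)).1 iv.
    congr (_.-integrable _ _); apply/funext => u.
    by rewrite patchE /v /ext0/=; case: ifPn.
have := v0 z; rewrite /v ext0_in// => /eqP; apply/negP.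
by rewrite gt_eqF// eta_gt0// /e; lra.
Qed.

End ConeUniqueness.

(** * Invariance of area under orthogonal maps *)

(** Provides the pushforward as a bundled measure, to which uniqueness theorems for measures
    apply. *)
Lemma ex_pushforward_measure (R : realType) (d1 d2 : measure_display)
    (T1 : measurableType d1) (T2 : measurableType d2)
    (m : {measure set T1 -> \bar R}) (f : T1 -> T2) :
  measurable_fun setT f ->
  exists nu : {measure set T2 -> \bar R}, forall A, nu A = m (f @^-1` A).
Proof. by move=> mf; unshelve eexists (pushforward m f). Qed.

(** The translated measure agrees with Lebesgue measure on half-open intervals, which determine
    it. *)
Lemma lebesgue_measure_translation (R : realType) (c : R)
    (A : set (measurableTypeR R)) : measurable A ->
  lebesgue_measure ((fun y : measurableTypeR R => c + y : measurableTypeR R) @^-1` A)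
  = lebesgue_measure A.
Proof.
have mT : measurable_fun setT
    (fun y : measurableTypeR R => c + y : measurableTypeR R).
  exact: measurable_funD.
have [nu nuE] := ex_pushforward_measure lebesgue_measure mT.
move=> mA; rewrite -nuE; apply/esym/lebesgue_measure_unique => //= X [[a b] _ <-].
rewrite nuE.
have -> : (fun y : R => c + y) @^-1` `]a, b] = `](a - c), (b - c)]%classic.
  by apply/seteqP; split=> y /=; rewrite !in_itv/= ltrBlDl lerBrDl.
rewrite [LHS]lebesgue_measure_itv [RHS]lebesgue_measure_itv/= !lte_fin ltrD2r; case: ifPn => // _.
by rewrite -!EFinD; congr EFin; ring.
Qed.

Definition area_preserving (R : realType) (T : plane R -> plane R) : Prop :=
  measurable_fun setT T /\
  forall A, measurable A -> area R (T @^-1` A) = area R A.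

Lemma area_preserving_comp (R : realType) (S T : plane R -> plane R) :
  area_preserving S -> area_preserving T -> area_preserving (T \o S).
Proof.
move=> [mS aS] [mT aT]; split; first exact: measurableT_comp.
move=> A mA; rewrite comp_preimage aS ?aT//.
by rewrite -[X in measurable X]setTI; exact: mT.
Qed.

(** The exchange of coordinates preserves the area of rectangles, and these determine the product
    measure. *)
Lemma area_preserving_swap (R : realType) :
  area_preserving (fun z : plane R => (z.2, z.1) : plane R).
Proof.
have mT : measurable_fun setT (fun z : plane R => (z.2, z.1) : plane R).
  by apply: measurable_fun_pair => //=.
split=> // A mA; have [nu nuE] := ex_pushforward_measure (area R) mT.
rewrite -nuE; apply/esym/product_measure_unique => // B C mB mC.
rewrite nuE [X in area R X](_ : _ = C `*` B); last first.
  by apply/seteqP; split=> -[x y] [].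
by apply: (eq_trans (product_measure1E _ _ mC mB)); exact: muleC.
Qed.

(** Cavalieri's principle: every vertical section is merely translated. *)
Lemma area_preserving_shear (R : realType) (c : R) :
  area_preserving (fun z : plane R => (z.1, c * z.1 + z.2) : plane R).
Proof.
split.
  apply: measurable_fun_pair => //=; apply: measurable_funD => //.
  by apply: measurable_funM.
move=> A mA; rewrite /area /product_measure1/=; apply: eq_integral => x _ /=.
rewrite -(@lebesgue_measure_translation _ (c * x) (xsection A x)); last first.
  exact: measurable_xsection.
congr (lebesgue_measure _); apply/seteqP; split=> y /=;
  by rewrite !xsectionE.
Qed.

Definition lin (R : realType) (a b c d : R) (z : R * R) : R * R :=
  (a * z.1 + b * z.2, c * z.1 + d * z.2).

(* A rotation is a product of three shears. *)
Lemma area_preserving_rot_aux (R : realType) (a b : R) :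
  a ^+ 2 + b ^+ 2 = 1 -> b != 0 ->
  area_preserving (lin a (- b) b a : plane R -> plane R).
Proof.
(* If [a] and [b] are the cosine and sine of an angle, [p] is minus the tangent of half that
   angle. *)
move=> ab b0; pose p := (a - 1) / b.
(* A horizontal shear is a vertical one conjugated by the exchange of coordinates. *)
have h2 : area_preserving (fun z : plane R => (z.1 + p * z.2, z.2) : plane R).
  have := area_preserving_comp (area_preserving_comp (@area_preserving_swap R)
    (area_preserving_shear p)) (@area_preserving_swap R).
  by congr area_preserving; apply/funext => z /=; rewrite addrC.
have := area_preserving_comp (area_preserving_comp h2
  (area_preserving_shear b)) h2.
congr area_preserving; apply/funext => z; rewrite /lin/=; congr pair; last first.
  by rewrite /p; field.
have -> : - b = p * (1 + a).
  apply: (mulIf b0); rewrite (_ : p * (1 + a) * b = a ^+ 2 - 1).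
    by rewrite -ab; ring.
  by rewrite /p; field.
by rewrite /p; field.
Qed.

Lemma area_preserving_rot (R : realType) (a b : R) :
  a ^+ 2 + b ^+ 2 = 1 -> area_preserving (lin a (- b) b a : plane R -> plane R).
Proof.
have [-> |b0 /area_preserving_rot_aux/(_ b0)//] := eqVneq b 0.
rewrite expr0n addr0 => /eqP; rewrite sqrf_eq1 => /orP[]/eqP->.
  have -> : lin 1 (- 0) 0 1 = id :> (R * R -> R * R).
    by apply/funext => -[x y]; rewrite /lin/= oppr0 !mul1r !mul0r addr0 add0r.
  by split=> //; exact: measurable_id.
(* The remaining case is the half-turn, the square of a quarter-turn, for which [b] is nonzero. *)
have r : area_preserving (lin 0 (- 1) 1 0 : plane R -> plane R).
  by apply: area_preserving_rot_aux; rewrite ?oner_eq0// expr0n expr1n add0r.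
have := area_preserving_comp r r; congr area_preserving; apply/funext => z.
by rewrite /lin/=; congr pair; ring.
Qed.

Definition orthonormal_rows (R : realType) (a b c d : R) : Prop :=
  [/\ a ^+ 2 + b ^+ 2 = 1, c ^+ 2 + d ^+ 2 = 1 & a * c + b * d = 0].

(** The determinant [D] is 1 or -1, and the second row is [D] times [(- b, a)]. The map is thus a
    rotation, or the exchange of coordinates followed by one. *)
Lemma area_preserving_lin (R : realType) (a b c d : R) :
  orthonormal_rows a b c d ->
  area_preserving (lin a b c d : plane R -> plane R).
Proof.
move=> [ab cd acbd]; pose D := a * d - b * c.
have D2 : D ^+ 2 = 1.
  have -> : D ^+ 2 = (a ^+ 2 + b ^+ 2) * (c ^+ 2 + d ^+ 2) - (a * c + b * d) ^+ 2.
    by rewrite /D; ring.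
  by rewrite ab cd acbd expr0n mulr1 subr0.
have cE : c = - b * D.
  rewrite -[LHS]mulr1 -ab (_ : - b * D =
    c * (a ^+ 2 + b ^+ 2) - a * (a * c + b * d)); last by rewrite /D; ring.
  by rewrite acbd mulr0 subr0.
have dE : d = a * D.
  rewrite -[LHS]mulr1 -ab (_ : a * D =
    d * (a ^+ 2 + b ^+ 2) - b * (a * c + b * d)); last by rewrite /D; ring.
  by rewrite acbd mulr0 subr0.
move: D2 => /eqP; rewrite sqrf_eq1 => /orP[]/eqP D1.
  have := @area_preserving_rot R a (- b); rewrite sqrrN => /(_ ab).
  by congr area_preserving; apply/funext => z; rewrite /lin cE dE D1 opprK !mulr1.
have := @area_preserving_rot R b (- a); rewrite sqrrN addrC => /(_ ab) r.
have := area_preserving_comp (@area_preserving_swap R) r.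
congr area_preserving; apply/funext => z; rewrite /lin/= cE dE D1.
by congr pair; ring.
Qed.

(** * Change of variables under area-preserving maps *)

Section AreaPreservingIntegral.
Context (R : realType) (T : plane R -> plane R).
Hypothesis aT : area_preserving T.
Variables (A : set (plane R)) (f : plane R -> R).
Hypotheses (mA : measurable A) (fi : (area R).-integrable A (EFin \o f)).

Local Open Scope ereal_scope.

Let g := (EFin \o f) \_ A.

Let gT : g \o T = (EFin \o (f \o T)) \_ (T @^-1` A).
Proof. by apply/funext => z; rewrite /g /= !patchE. Qed.

Let mT : measurable_fun setT T. Proof. by have [] := aT. Qed.

Let mTA : measurable (T @^-1` A).
Proof. by rewrite -[X in measurable X]setTI; exact: mT. Qed.

Let mg : measurable_fun setT g.
Proof. by have [] := integrableP _ _ _ ((integrable_mkcond (EFin \o f) mA).1 fi). Qed.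

Let integral_pushforwardE (h : plane R -> \bar R) :
  \int[pushforward (area R) T]_x h x = \int[area R]_x h x.
Proof.
have [nu nuE] := ex_pushforward_measure (area R) mT.
rewrite (_ : pushforward (area R) T = nu); last by apply/funext => B; rewrite nuE.
by apply: eq_measure_integral => B mB _; rewrite nuE; have [_] := aT; exact.
Qed.

Let ig : (area R).-integrable setT (g \o T).
Proof.
apply/integrableP; split; first exact: measurableT_comp.
have [_] := integrableP _ _ _ ((integrable_mkcond (EFin \o f) mA).1 fi).
rewrite -integral_pushforwardE ge0_integral_pushforward//.
exact: measurableT_comp.
Qed.

Lemma area_preserving_integrable :
  (area R).-integrable (T @^-1` A) (EFin \o (f \o T)).
Proof. by apply/(integrable_mkcond _ mTA); rewrite -gT. Qed.

(** With [f] extended by 0 off [A], both sides become integrals over the plane, one against area and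
    one against its pushforward; these agree on measurable sets. *)
Lemma area_preserving_Rintegral :
  (\int[area R]_(z in A) f z = \int[area R]_(z in T @^-1` A) f (T z))%R.
Proof.
rewrite /Rintegral; congr fine.
rewrite [LHS]integral_mkcond [RHS]integral_mkcond -/g.
rewrite -[in RHS]gT -integral_pushforwardE.
by rewrite integral_pushforward// preimage_setT.
Qed.

End AreaPreservingIntegral.

(** * The three sectors *)

Section LinearChange.
Context (R : realType) (a b c d : R).
Local Notation T := (lin a b c d).

Lemma linD (z w : R * R) : T (z + w) = T z + T w.
Proof. by rewrite /lin; congr pair => /=; ring. Qed.

Lemma linZ (t : R) (z : R * R) : T (t *: z) = t *: T z.
Proof. by rewrite /lin; congr pair; rewrite /= /GRing.scale/=; ring. Qed.

Lemma continuous_lin : continuous T.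
Proof.
have cl p q : continuous (fun z : R * R => p * z.1 + q * z.2).
  by move=> z; apply: cvgD; apply: cvgMl_tmp; [exact: cvg_fst|exact: cvg_snd].
by move=> z; exact: (cvg_pair (cl a b z) (cl c d z)).
Qed.

Lemma is_derive_comp_lin (h : R * R -> R) (z v : R * R) (dh : R) :
  is_derive (T z) (T v) (h : R * R -> R^o) dh ->
  is_derive z v ((h \o T) : R * R -> R^o) dh.
Proof.
move=> /is_derive_cvgP dhT; apply/is_derive_cvgP; apply: cvg_trans dhT.
by apply: near_eq_cvg; near=> t; rewrite /= linD linZ.
Unshelve. all: by end_near. Qed.

Lemma C1_on_data (U : set (R * R)) (h : R * R -> R) :
  C1_on U h -> C1data U h (partial1 h) (partial2 h).
Proof. by move=> hC1 z /hC1[d1 d2 c1 c2]; split => //; exact: derivableP. Qed.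

(** In the Laplacian of [h \o T] the pure second derivatives of [h] get the squared norms of the
    rows as coefficients, and both mixed ones get the inner product of the rows. Orthonormality
    leaves the Laplacian of [h] at [T z]. *)
Lemma regular_harmonic_comp_lin (U V : set (R * R)) (h : R * R -> R) :
  open V -> orthonormal_rows a b c d -> harmonic_on V h ->
  (forall z, U z -> V (T z)) -> regular_harmonic U (h \o T).
Proof.
move=> oV [ab cd acbd] [/C1_on_data Ch /C1_on_data Ch1 /C1_on_data Ch2 lap] UV.
set h1 := partial1 h in Ch Ch1 lap *; set h2 := partial2 h in Ch Ch2 lap *.
set h11 := partial1 h1 in Ch1 lap *; set h12 := partial2 h1 in Ch1 *.
set h21 := partial1 h2 in Ch2 *; set h22 := partial2 h2 in Ch2 lap *.
have cT (f : R * R -> R) (z : R * R) : {for T z, continuous f} -> {for z, continuous (f \o T)}.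
  by move=> cf; exact: (@continuous_comp _ _ _ T f z (@continuous_lin z) cf).
have T1 : T (dir1 R) = (a, c) by rewrite /lin/= !mulr1 !mulr0 !addr0.
have T2 : T (dir2 R) = (b, d) by rewrite /lin/= !mulr1 !mulr0 !add0r.
have D (f f1 f2 : R * R -> R) z v : C1data V f f1 f2 -> U z ->
    is_derive z v ((f \o T) : R * R -> R^o)
      ((T v).1 * f1 (T z) + (T v).2 * f2 (T z)).
  by move=> Cf /UV Vz; apply: is_derive_comp_lin; exact: C1data_is_derive Vz.
have DD (p q : R) z v : U z ->
    is_derive z v ((fun w => p * h1 (T w) + q * h2 (T w)) : R * R -> R^o)
      (p * ((T v).1 * h11 (T z) + (T v).2 * h12 (T z)) +
       q * ((T v).1 * h21 (T z) + (T v).2 * h22 (T z))).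
  move=> Uz.
  exact: (is_deriveD (is_deriveZ p (D _ _ _ z v Ch1 Uz))
                     (is_deriveZ q (D _ _ _ z v Ch2 Uz))).
have CC (p q : R) (f1 f2 : R * R -> R) z :
    {for T z, continuous f1} -> {for T z, continuous f2} ->
    {for z, continuous (fun w => p * f1 (T w) + q * f2 (T w))}.
  by move=> c1 c2; apply: cvgD; apply: cvgMl_tmp; exact: cT.
exists (fun z => a * h1 (T z) + c * h2 (T z)).
exists (fun z => b * h1 (T z) + d * h2 (T z)).
exists (fun z => a * (a * h11 (T z) + c * h12 (T z)) +
                 c * (a * h21 (T z) + c * h22 (T z))).
exists (fun z => b * (b * h11 (T z) + d * h12 (T z)) +
                 d * (b * h21 (T z) + d * h22 (T z))).
move=> z Uz; have Vz := UV z Uz.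
have [_ _ c11 c12] := Ch1 _ Vz; have [_ _ c21 c22] := Ch2 _ Vz.
have [_ _ c1 c2] := Ch _ Vz.
split.
- split.
  + by have := D _ _ _ z (dir1 R) Ch Uz; rewrite T1.
  + by have := D _ _ _ z (dir2 R) Ch Uz; rewrite T2.
  + by have := DD a c z (dir1 R) Uz; rewrite T1.
  + by have := DD b d z (dir2 R) Uz; rewrite T2.
- split; [|exact: CC|exact: CC| |].
  + exact: (cT h z (C1data_continuous oV Ch Vz)).
  + by apply: cvgD; apply: cvgMl_tmp; apply: (CC _ _ _ _ z).
  + by apply: cvgD; apply: cvgMl_tmp; apply: (CC _ _ _ _ z).
- move: (lap _ Vz) => {lap}.
  move: (h11 _) (h12 _) (h21 _) (h22 _) => x11 x12 x21 x22 lap.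
  transitivity ((a ^+ 2 + b ^+ 2) * x11 + (c ^+ 2 + d ^+ 2) * x22
    + (a * c + b * d) * (x12 + x21)); first by ring.
  by rewrite ab cd acbd mul0r addr0 !mul1r.
Qed.

End LinearChange.

Lemma regular_harmonicB (R : realType) (U : set (R * R)) (f g : R * R -> R) :
  regular_harmonic U f -> regular_harmonic U g -> regular_harmonic U (f \- g).
Proof.
move=> [f1 [f2 [f11 [f22 F]]]] [g1 [g2 [g11 [g22 G]]]].
exists (f1 \- g1), (f2 \- g2), (f11 \- g11), (f22 \- g22) => z Uz.
have [[? ? ? ?] [? ? ? ? ?] fz] := F z Uz.
have [[? ? ? ?] [? ? ? ? ?] gz] := G z Uz.
split; first by split; exact: is_deriveB.
- by split; exact: cvgB.
- by rewrite /= addrACA -opprD fz gz subr0.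
Qed.

(** * Sectors around the cube roots of unity *)

Section Sectors.
Context (R : realType).

Definition dotp (u z : R * R) : R := u.1 * z.1 + u.2 * z.2.

(** The cube roots of unity as points of the plane; the last clause serves index 2 and makes the
    function total. *)
Definition root3 (n : nat) : R * R :=
  match n with
  | 0 => (1, 0)
  | 1 => (- (1 / 2), Num.sqrt 3 / 2)
  | _ => (- (1 / 2), - (Num.sqrt 3 / 2))
  end.

(* The ell n sum to 0, and the sectors are the regions where one of them is the
   strict maximum, so that permuting the ell n permutes the sectors. *)
Definition ell (n : nat) (z : R * R) : R := dotp (root3 n) z.

Definition sector (i : 'I_3) : set (R * R) :=
  [set z | forall j : 'I_3, j != i -> ell j z < ell i z].

Lemma sqrt3_sqr : Num.sqrt 3 * Num.sqrt 3 = 3 :> R.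
Proof. by rewrite -expr2 sqr_sqrtr. Qed.

Lemma ord3_third (i j : 'I_3) : i != j -> exists k : 'I_3, k != i /\ k != j.
Proof.
move: i j => [[|[|[|//]]] ?] [[|[|[|//]]] ?] // _;
  first [by exists (@Ordinal 3 0 isT)|by exists (@Ordinal 3 1 isT)
        |by exists (@Ordinal 3 2 isT)].
Qed.

Lemma ord3_cover (i j k l : 'I_3) : i != j -> k != i -> k != j ->
  [|| l == i, l == j | l == k].
Proof.
by move: i j k l => [[|[|[|//]]] ?] [[|[|[|//]]] ?] [[|[|[|//]]] ?] [[|[|[|//]]] ?].
Qed.

Lemma dotp_root3 (i j : 'I_3) :
  dotp (root3 i) (root3 j) = if i == j then 1 else - (1 / 2).
Proof.
have ss := sqrt3_sqr; move: i j => [[|[|[|//]]] ?] [[|[|[|//]]] ?];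
  rewrite /dotp /root3/=; move: (Num.sqrt 3) ss => s ss; lra.
Qed.

Lemma root3_sum (i j k : 'I_3) : i != j -> k != i -> k != j ->
  root3 i + root3 j + root3 k = 0.
Proof.
by move: i j k => [[|[|[|//]]] ?] [[|[|[|//]]] ?] [[|[|[|//]]] ?] // _ _ _;
  rewrite /root3/=; move: (Num.sqrt 3) => s; congr pair => /=; lra.
Qed.

Lemma dotpD u z w : dotp u (z + w) = dotp u z + dotp u w.
Proof. by rewrite /dotp /=; ring. Qed.

Lemma dotpZ u t z : dotp u (t *: z) = t * dotp u z.
Proof. by rewrite /dotp /= /GRing.scale/=; ring. Qed.

Lemma ell_root3 (i j : 'I_3) : j != i -> ell j (root3 i) = - (1 / 2).
Proof. by rewrite /ell dotp_root3 => /negPf ->. Qed.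

Lemma ell_root3_diag (i : 'I_3) : ell i (root3 i) = 1.
Proof. by rewrite /ell dotp_root3 eqxx. Qed.

(* The isometry that maps root3 0, root3 1, root3 2 to root3 i, root3 j, root3 k. *)
Definition sector_iso (i j k : 'I_3) (z : R * R) : R * R :=
  (2 / 3) *: (ell 0 z *: root3 i + ell 1 z *: root3 j + ell 2 z *: root3 k).

Lemma ell_sum z : ell 0 z + ell 1 z + ell 2 z = 0.
Proof. by rewrite /ell /dotp /root3/=; lra. Qed.

(** The Gram matrix of the roots is 3 / 2 times the identity minus 1 / 2 times the all-ones matrix.
    The latter kills the values [ell n z], whose sum is 0, and the factor 2 / 3 undoes the
    former. *)
Lemma ell_sector_iso (i j k : 'I_3) z : i != j -> k != i -> k != j ->
  [/\ ell i (sector_iso i j k z) = ell 0 z,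
      ell j (sector_iso i j k z) = ell 1 z &
      ell k (sector_iso i j k z) = ell 2 z].
Proof.
move=> ij ki kj; have ez := ell_sum z.
have E l : ell l (sector_iso i j k z) = 2 / 3 * (ell 0 z * dotp (root3 l) (root3 i)
    + ell 1 z * dotp (root3 l) (root3 j) + ell 2 z * dotp (root3 l) (root3 k)).
  by rewrite /sector_iso {1}/ell dotpZ !dotpD !dotpZ.
rewrite !E !dotp_root3 !eqxx.
rewrite [j == i]eq_sym [i == k]eq_sym [j == k]eq_sym.
rewrite (negPf ij) (negPf ki) (negPf kj).
by split; lra.
Qed.

Lemma sector_iso_lin (i j k : 'I_3) : i != j -> k != i -> k != j ->
  exists a b c d, orthonormal_rows a b c d /\ sector_iso i j k = lin a b c d.
Proof.
(* The matrix is 2 / 3 times the sum of the rank-one matrices pairing each root with its image; [f]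
   selects the input coordinate and [g] the output coordinate. *)
pose p (f g : R * R -> R) := 2 / 3 * (f (root3 0) * g (root3 i) +
  f (root3 1) * g (root3 j) + f (root3 2) * g (root3 k)).
move=> ij ki kj; exists (p fst fst), (p snd fst), (p fst snd), (p snd snd).
split; last first.
  by apply/funext => z; congr pair; 
    rewrite /p /ell /dotp /GRing.scale/= /GRing.scale/=; ring.
have ss := sqrt3_sqr; rewrite /orthonormal_rows /p.
(* For [lra] the powers of the square root are unrelated monomials; their values are supplied up to
   degree 4, which products of two entries can reach. *)
have s3 : Num.sqrt 3 * Num.sqrt 3 * Num.sqrt 3 = 3 * Num.sqrt 3 :> R by rewrite ss.
have s4 : Num.sqrt 3 * Num.sqrt 3 * Num.sqrt 3 * Num.sqrt 3 = 9 :> R.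
  by rewrite ss -mulrA ss -natrM.
move: i j k ij ki kj {p}
  => [[|[|[|//]]] ?] [[|[|[|//]]] ?] [[|[|[|//]]] ?] // _ _ _;
  rewrite /root3/=; move: (Num.sqrt 3) ss s3 s4 => s ss s3 s4; split; lra.
Qed.

(** For distinct indices the two maps are mirror images of each other, and they agree on the line
    sent to the mirror. *)
Lemma sector_iso_swap (i j k : 'I_3) z : ell 0 z = ell 1 z ->
  sector_iso i j k z = sector_iso j i k z.
Proof. by rewrite /sector_iso => ->; rewrite [X in X + _]addrC. Qed.

Lemma sector_iso_dir (i j k : 'I_3) : i != j -> k != i -> k != j ->
  sector_iso i j k (dir1 R) = root3 i.
Proof.
move=> ij ki kj; have := root3_sum ij ki kj; move=> /eqP.
rewrite -addrA addr_eq0 => /eqP E.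
rewrite /sector_iso -addrA.
have -> : ell 0 (dir1 R) = 1 by rewrite /ell /dotp/=; ring.
have -> : ell 1 (dir1 R) = - (1 / 2) by rewrite /ell /dotp/=; ring.
have -> : ell 2 (dir1 R) = - (1 / 2) by rewrite /ell /dotp/=; ring.
rewrite -scalerDr (_ : root3 j + root3 k = - root3 i); last by rewrite E opprK.
by rewrite scalerN scaleNr opprK -scalerDl scalerA -[RHS]scale1r; congr (_ *: _); field.
Qed.

Lemma sectorE (i j k : 'I_3) : i != j -> k != i -> k != j ->
  sector i = [set z | ell j z < ell i z] `&` [set z | ell k z < ell i z].
Proof.
move=> ij ki kj; apply/seteqP; split=> z /=.
  by move=> H; split; apply: H => //; rewrite eq_sym.
move=> [H1 H2] l; have /or3P[/eqP->|/eqP->|/eqP->]// := ord3_cover l ij ki kj.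
by rewrite eqxx.
Qed.

(** The two inequalities defining the sector become [ell 1 z < ell 0 z] and [ell 2 z < ell 0 z],
    which bound [z.2] above and below by plus and minus [Num.sqrt 3 * z.1]. *)
Lemma preimage_sector_iso (i j k : 'I_3) : i != j -> k != i -> k != j ->
  sector_iso i j k @^-1` sector i = cone (Num.sqrt 3).
Proof.
move=> ij ki kj; rewrite (sectorE ij ki kj).
have ss := sqrt3_sqr; have s0 : 0 < Num.sqrt 3 :> R by rewrite sqrtr_gt0.
apply/seteqP; split=> z; rewrite /preimage/= /cone/=;
  have [-> -> ->] := ell_sector_iso z ij ki kj;
  rewrite /ell /dotp /root3/=; move: (Num.sqrt 3) ss s0 => s ss s0.
- by move=> [h1 h2]; rewrite ltr_norml; apply/andP; split;
    rewrite -(ltr_pM2l s0) ?mulrN mulrA ss; lra.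
- rewrite ltr_norml -(ltr_pM2l s0) -[X in _ && X](ltr_pM2l s0) mulrN !mulrA ss.
  by move=> /andP[h1 h2]; split; lra.
Qed.

Lemma continuous_ell (n : nat) : continuous (ell n).
Proof.
by move=> z; apply: cvgD; apply: cvgMl_tmp; [exact: cvg_fst|exact: cvg_snd].
Qed.

Lemma open_ell_lt (i j : nat) : open [set z | ell j z < ell i z].
Proof.
have -> : [set z | ell j z < ell i z] =
    (fun z => ell i z - ell j z) @^-1` [set x | 0 < x].
  by apply/seteqP; split=> z /=; rewrite subr_gt0.
apply: open_comp; last exact: open_gt.
by move=> z _; apply: cvgB; exact: continuous_ell.
Qed.

Lemma measurable_ell_lt (i j : nat) :
  measurable ([set z | ell j z < ell i z] : set (plane R)).
Proof.
have me n : measurable_fun setT (ell n : plane R -> R).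
  by apply: measurable_funD; apply: measurable_funM.
have mB : measurable_fun setT ((fun z => ell i z - ell j z) : plane R -> R).
  exact: measurable_funB.
have := mB measurableT `]0, +oo[%classic (measurable_itv _).
rewrite setTI; congr measurable; apply/seteqP; split=> z /=;
  by rewrite in_itv/= andbT subr_gt0.
Qed.

Lemma open_sector (i : 'I_3) : open (sector i).
Proof.
have [j ji] : exists j : 'I_3, i != j.
  by case: (eqVneq i ord0) => [->|ni]; [exists ord_max|exists ord0].
have [k [ki kj]] := ord3_third ji; rewrite (sectorE ji ki kj).
by apply: openI; exact: open_ell_lt.
Qed.

Lemma measurable_sector (i : 'I_3) : measurable (sector i : set (plane R)).
Proof.
have [j ji] : exists j : 'I_3, i != j.
  by case: (eqVneq i ord0) => [->|ni]; [exists ord_max|exists ord0].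
have [k [ki kj]] := ord3_third ji; rewrite (sectorE ji ki kj).
by apply: measurableI; exact: measurable_ell_lt.
Qed.

Lemma sector_root3 (i : 'I_3) : sector i (root3 i).
Proof. by move=> j ji; rewrite ell_root3// ell_root3_diag; lra. Qed.

Lemma sector_disjoint (i j : 'I_3) : i != j -> sector i `&` sector j = set0.
Proof.
move=> ij; apply/seteqP; split=> // z [/(_ j)]; rewrite eq_sym => /(_ ij) h.
by move=> /(_ i ij); rewrite ltNge ltW.
Qed.

Lemma ellD n z w : ell n (z + w) = ell n z + ell n w.
Proof. exact: dotpD. Qed.

Lemma ellZ n t z : ell n (t *: z) = t * ell n z.
Proof. exact: dotpZ. Qed.

Lemma continuous_line (z w : R * R) : continuous (fun t : R => z + t *: w).
Proof.
move=> t; apply: cvgD; first exact: cvg_cst.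
exact: scalel_continuous.
Qed.

(** The sector is star-shaped about [root3 i], hence a union of segments through that point. *)
Lemma connected_sector (i : 'I_3) : connected (sector i).
Proof.
pose seg z := (fun t : R => root3 i + t *: (z - root3 i)) @` `[0, 1].
have segS z : sector i z -> seg z `<=` sector i.
  move=> iz _ [t /= + <-] j ji; rewrite in_itv/= => /andP[t0 t1].
  have E n : ell n (root3 i + t *: (z - root3 i)) =
      (1 - t) * ell n (root3 i) + t * ell n z.
    by rewrite /ell /dotp/= /GRing.scale/=; ring.
  rewrite !E ell_root3// ell_root3_diag.
  have := iz j ji; rewrite -subr_gt0 => ez.
  have [->|tn0] := eqVneq t 0; first lra.
  have : 0 < t * (ell i z - ell j z) by rewrite mulr_gt0// lt0r tn0.
  lra.
have -> : sector i = \bigcup_(z in sector i) seg z.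
  apply/seteqP; split=> [z iz|z [w iw]]; last exact: segS.
  exists z => //; exists 1; first by rewrite /= in_itv/= ler01 lexx.
  by rewrite scale1r addrCA subrr addr0.
apply: bigcup_connected.
  exists (root3 i) => z _; exists 0; first by rewrite /= in_itv/= ler01 lexx.
  by rewrite scale0r addr0.
move=> z _; apply: connected_continuous_connected; first exact: segment_connected.
exact/continuous_subspaceT/continuous_line.
Qed.

(** The tie keeps [z] out of the sector, while any push along [root3 i] raises [ell i] and lowers
    the others, so points of the sector accumulate at [z]. The vertex is covered too. *)
Lemma boundary_sector (i j : 'I_3) (z : R * R) : j != i ->
  (forall l : 'I_3, ell l z <= ell i z) -> ell j z = ell i z ->
  boundary (sector i) z.
Proof.
move=> ji iz jz; split; last first.
  by move=> /interior_subset /(_ j ji); rewrite jz ltxx.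
move=> B Bz; have cB : \forall t \near (0 : R), B (z + t *: root3 i).
  by have := @continuous_line z (root3 i) 0; apply; rewrite /= scale0r addr0.
near (0 : R)^'+ => t; exists (z + t *: root3 i); split; last first.
  by near: t; exact: (cvg_at_right_filter cvg_id).
move=> l li; rewrite !ellD !ellZ ell_root3// ell_root3_diag.
have t0 : 0 < t by near: t; exact: nbhs_right_gt.
by have := iz l; lra.
Unshelve. all: by end_near. Qed.

End Sectors.

(** * Symmetry of test functions in the common side of two sectors *)

Section SymmetricTestFunctions.
Context (R : realType) (i j k : 'I_3) (h : R * R -> R).
Hypotheses (ij : i != j) (ki : k != i) (kj : k != j)
  (th : test_function (@sector R) i j h).
Notation T := (@sector_iso R i j k).
Notation T' := (@sector_iso R j i k).
Notation C := (@cone R (Num.sqrt 3)).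

Let ji : j != i. Proof. by rewrite eq_sym. Qed.

Lemma sector_of_cone z : C z -> sector i (T z).
Proof. by rewrite -(preimage_sector_iso R ij ki kj). Qed.

Lemma sector_of_cone' z : C z -> sector j (T' z).
Proof. by rewrite -(preimage_sector_iso R ji kj ki). Qed.

Lemma area_preserving_sector_iso (a b c : 'I_3) :
  a != b -> c != a -> c != b ->
  area_preserving (sector_iso a b c : plane R -> plane R).
Proof.
move=> ab ca cb; have [m1 [m2 [m3 [m4 [abcd ->]]]]] := sector_iso_lin R ab ca cb.
exact: area_preserving_lin.
Qed.

Lemma continuous_sector_iso (a b c : 'I_3) :
  a != b -> c != a -> c != b -> continuous (@sector_iso R a b c).
Proof.
move=> ab ca cb; have [m1 [m2 [m3 [m4 [abcd ->]]]]] := sector_iso_lin R ab ca cb.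
exact: continuous_lin.
Qed.

Let V := sector i `|` sector j : set (R * R).

Let hV : harmonic_on V h. Proof. by have [ [] ] := th. Qed.

Let ih : (area R).-integrable V (EFin \o (h : plane R -> R)).
Proof. by have [ [] ] := th. Qed.

Let oV : open V. Proof. by apply: openU; exact: open_sector. Qed.

Let ihi : (area R).-integrable (sector i) (EFin \o (h : plane R -> R)).
Proof.
apply: (integrableS _ _ _ ih); last exact: subsetUl.
  by apply: measurableU; exact: measurable_sector.
exact: measurable_sector.
Qed.

Let ihj : (area R).-integrable (sector j) (EFin \o (h : plane R -> R)).
Proof.
apply: (integrableS _ _ _ ih); last exact: subsetUr.
  by apply: measurableU; exact: measurable_sector.
exact: measurable_sector.
Qed.

Let regT : regular_harmonic C (h \o T).
Proof.
have [m1 [m2 [m3 [m4 [mnpq E]]]]] := sector_iso_lin R ij ki kj.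
rewrite E; apply: (regular_harmonic_comp_lin oV mnpq hV) => z Cz.
by left; rewrite -E; exact: sector_of_cone.
Qed.

Let regT' : regular_harmonic C (h \o T').
Proof.
have [m1 [m2 [m3 [m4 [mnpq E]]]]] := sector_iso_lin R ji kj ki.
rewrite E; apply: (regular_harmonic_comp_lin oV mnpq hV) => z Cz.
by right; rewrite -E; exact: sector_of_cone'.
Qed.

Let ihT : (area R).-integrable C (EFin \o ((h \o T) : plane R -> R)).
Proof.
have := area_preserving_integrable (area_preserving_sector_iso ij ki kj)
  (@measurable_sector R i) ihi.
by rewrite preimage_sector_iso.
Qed.

Let ihT' : (area R).-integrable C (EFin \o ((h \o T') : plane R -> R)).
Proof.
have := area_preserving_integrable (area_preserving_sector_iso ji kj ki)
  (@measurable_sector R j) ihj.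
by rewrite preimage_sector_iso.
Qed.

(** The continuous extension [H] takes equal values at the two images [T z] and [T' z] of a boundary
    point, even where these images differ. *)
Let boundary_diff z : ~ C z -> forall e, 0 < e ->
  \forall w \near z, C w -> `|((h \o T) \- (h \o T')) w| < e.
Proof.
move=> nCz e e0; have [_ [H [Hh cH H0]]] := th.
pose K : set (R * R) := V `|` (boundary (sector i) `&` boundary (sector j))
  `|` other_boundaries (@sector R) i j.
have CE w : C w <-> ell 1 w < ell 0 w /\ ell 2 w < ell 0 w.
  rewrite -(preimage_sector_iso R ij ki kj) (sectorE R ij ki kj).
  by rewrite /preimage/=; have [-> -> ->] := ell_sector_iso w ij ki kj.
(* Off the closed cone the claim is vacuous: no point of the cone is near [z]. *)
have out (n : nat) : ell 0 z < ell n z -> (n = 1 \/ n = 2)%N ->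
    \forall w \near z, C w -> `|((h \o T) \- (h \o T')) w| < e.
  move=> zn n12; have : \forall w \near z, ell 0 w < ell n w.
    by apply: open_nbhs_nbhs; split => //; exact: open_ell_lt.
  apply: filterS => w wn /CE[w1 w2]; exfalso.
  by case: n12 wn => -> ; rewrite ltNge ltW.
have [z1|z1] := ltP (ell 0 z) (ell 1 z); first by apply: (out 1%N) => //; left.
have [z2|z2] := ltP (ell 0 z) (ell 2 z); first by apply: (out 2%N) => //; right.
have [e1 e2 e3] := ell_sector_iso z ij ki kj.
have [e1' e2' e3'] := ell_sector_iso z ji kj ki.
have leT (l : 'I_3) : ell l (T z) <= ell i (T z).
  by have /or3P[/eqP->|/eqP->|/eqP->] := ord3_cover l ij ki kj;
    rewrite ?e1 ?e2 ?e3.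
have leT' (l : 'I_3) : ell l (T' z) <= ell j (T' z).
  by have /or3P[/eqP->|/eqP->|/eqP->] := ord3_cover l ij ki kj;
    rewrite ?e1' ?e2' ?e3'.
have ik : i != k by rewrite eq_sym.
have jk : j != k by rewrite eq_sym.
have other_k w : boundary (sector k) w -> other_boundaries (@sector R) i j w.
  by move=> kw; exists k.
(* On the side [ell 0 z = ell 1 z] the two images coincide and lie on both boundaries; on the side
   [ell 0 z = ell 2 z] both lie on the boundary of the third sector, where [H] is 0. *)
have [KT [KT' HTT]] : K (T z) /\ K (T' z) /\ H (T z) = H (T' z).
  have : ell 0 z = ell 1 z \/ ell 0 z = ell 2 z.
    have [|n1] := eqVneq (ell 0 z) (ell 1 z); first by left.
    have [|n2] := eqVneq (ell 0 z) (ell 2 z); first by right.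
    by exfalso; apply: nCz; apply/CE; rewrite !lt_neqAle z1 z2 !(eq_sym _ (ell 0 z)) n1 n2.
  case=> [z01|z02].
    have TT : T z = T' z by exact: sector_iso_swap.
    have KTz : K (T z).
      left; right; split.
        by apply: (boundary_sector ji) => //; rewrite e1 e2.
      apply: (boundary_sector ij); last by rewrite e1 e2.
      by move=> l; rewrite (le_trans (leT l))// e1 e2 z01.
    by rewrite -TT.
  have bT : boundary (sector k) (T z).
    apply: (boundary_sector ik); last by rewrite e1 e3.
    by move=> l; rewrite (le_trans (leT l))// e1 e3 z02.
  have bT' : boundary (sector k) (T' z).
    apply: (boundary_sector jk); last by rewrite e1' e3'.
    by move=> l; rewrite (le_trans (leT' l))// e1' e3' z02.
  split; first by right; exact: other_k.
  split; first by right; exact: other_k.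
  by rewrite !H0//; exact: other_k.
(* [H] is continuous only relative to [K], so the estimate concerns points sent into [K]; points of
   the cone qualify, as their images lie in [V]. *)
have cHz (S : R * R -> R * R) : {for z, continuous S} -> K (S z) ->
    \forall w \near z, K (S w) -> `|H (S z) - H (S w)| < e / 2.
  move=> cS KS; have /subspace_continuousP/(_ _ KS)/cvgrPdist_lt := cH.
  move=> /(_ (e / 2)); rewrite divr_gt0// => /(_ isT).
  rewrite near_withinE => /cS.
  exact.
have nT := cHz T (@continuous_sector_iso _ _ _ ij ki kj z) KT.
have nT' := cHz T' (@continuous_sector_iso _ _ _ ji kj ki z) KT'.
apply: filterS2 nT nT' => w wT wT' Cw.
have Vi : V (T w) by left; exact: sector_of_cone.
have Vj : V (T' w) by right; exact: sector_of_cone'.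
have {}wT : `|H (T z) - H (T w)| < e / 2 by apply: wT; left; left.
have {}wT' : `|H (T' z) - H (T' w)| < e / 2 by apply: wT'; left; left.
rewrite /= -!Hh//.
have -> : H (T w) - H (T' w) =
    (H (T' z) - H (T' w)) - (H (T z) - H (T w)) by rewrite HTT; ring.
by rewrite (le_lt_trans (ler_normB _ _))//; lra.
Qed.

(** [cone_harmonic_le0] applies to the difference and to its opposite. *)
Lemma test_function_sym z : C z -> h (T z) = h (T' z).
Proof.
move=> Cz; have q0 : 0 < Num.sqrt 3 :> R by rewrite sqrtr_gt0.
have iB (f g : plane R -> R) : (area R).-integrable C (EFin \o f) ->
    (area R).-integrable C (EFin \o g) ->
    (area R).-integrable C (EFin \o (f \- g)).
  move=> If Ig; rewrite (_ : _ \o _ = (EFin \o f) \- (EFin \o g))%E//.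
  by apply: integrableB => //; exact: measurable_cone.
apply/eqP; rewrite -subr_eq0 eq_le; apply/andP; split.
  exact: (cone_harmonic_le0 q0 (regular_harmonicB regT regT') boundary_diff
    (iB _ _ ihT ihT') Cz).
rewrite -oppr_le0 opprB.
apply: (cone_harmonic_le0 q0 (regular_harmonicB regT' regT) _
  (iB _ _ ihT' ihT) Cz).
move=> w Cw e e0; apply: filterS (boundary_diff Cw e0) => u.
by rewrite /= distrC.
Qed.

(** Both integrals pull back to the same cone, where the integrands agree. The factor 1 is the
    weight of the phase. *)
Lemma test_function_Rintegral :
  (\int[area R]_(x in (sector i : set (plane R))) (h x * 1)
   = \int[area R]_(x in (sector j : set (plane R))) (h x * 1))%R.
Proof.
under [LHS]eq_Rintegral do rewrite mulr1.
under [RHS]eq_Rintegral do rewrite mulr1.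
rewrite (area_preserving_Rintegral (area_preserving_sector_iso ij ki kj)
  (@measurable_sector R i) ihi).
rewrite (area_preserving_Rintegral (area_preserving_sector_iso ji kj ki)
  (@measurable_sector R j) ihj).
rewrite !preimage_sector_iso//; apply: eq_Rintegral => z; rewrite inE => Cz.
exact: test_function_sym.
Qed.

(** Both points are images of [(1, 0)], which lies on the axis of the cone. *)
Lemma test_function_root3 : h (root3 R i) = h (root3 R j).
Proof.
rewrite -(sector_iso_dir R ij ki kj) -(sector_iso_dir R ji kj ki).
apply: test_function_sym.
by rewrite /cone/= normr0 mulr1 sqrtr_gt0.
Qed.

End SymmetricTestFunctions.

(** * Dirac masses and the conclusion *)

Lemma integral_dirac_in (R : realType) (a : plane R) (D : set (plane R))
    (f : plane R -> R) :
  measurable D -> measurable_fun D f -> D a ->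
  (\d_a : set (plane R) -> \bar R).-integrable D (EFin \o f) /\
  \int[\d_a]_(x in D) f x = f a.
Proof.
move=> mD mf Da; have mEf : measurable_fun D (EFin \o f) by exact/measurable_EFinP.
split.
  apply/integrableP; split=> //; rewrite integral_dirac//; last first.
    exact: measurableT_comp.
  by rewrite diracE mem_set// mul1e ltry.
by rewrite /Rintegral integral_dirac// diracE mem_set// mul1e.
Qed.

(** Any other point has the complement of [a] as an open neighbourhood of mass 0. *)
Lemma supp_dirac (R : realType) (a : plane R) :
  supp (\d_a : {measure set (plane R) -> \bar R}) `<=` [set a].
Proof.
move=> x xa /=; apply: contrapT => nxa.
have oa : open (~` [set (a : R * R)]).
  apply: closed_openC; apply: accessible_closed_set1.
  exact/hausdorff_accessible/norm_hausdorff.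
have : (0 < (\d_a : set (plane R) -> \bar R) (~` [set a]))%E := xa _ oa nxa.
by rewrite diracE memNset ?ltxx//=; apply.
Qed.

Theorem theorem9 (R : realType) :
  exists (m : nat)
         (mu : 'I_m -> {finite_measure set (plane R) -> \bar R})
         (lambda : 'I_m -> R)
         (Omega : 'I_m -> set (R * R))
         (x0 : R * R),
    [/\ (3 <= m)%N,
        forall i, (0 < mu i setT)%E,
        forall i, 0 < lambda i &
        [/\ multiphase_quadrature_domain mu lambda Omega,
            #|[pred i : 'I_m | x0 \in boundary (Omega i)]| = 3%N &
            forall i, ~ supp (mu i) x0]].
Proof.
exists 3, (fun i => \d_(root3 R i : plane R)), (fun=> 1), (@sector R), (0, 0).
have su (i : 'I_3) := @supp_dirac R (root3 R i).
split=> //.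
- by move=> i; rewrite /= diracT lte01.
- split.
  + split.
    * move=> i; split; first by exists (root3 R i); exact: sector_root3.
        exact: open_sector.
      exact: connected_sector.
    * by move=> i j; exact: sector_disjoint.
    * by move=> i x /su ->; exact: sector_root3.
    * move=> i j ij h th; have [k [ki kj]] := ord3_third ij.
      have mU : measurable (sector i `|` sector j : set (plane R)).
        by apply: measurableU; exact: measurable_sector.
      have mh : measurable_fun (sector i `|` sector j : set (plane R))
          (h : plane R -> R).
        by have [ [_ /integrableP[/measurable_EFinP] ] ] := th.
      (* Both roots lie in the union of the two sectors, so the Dirac integrals reduce to values of
         [h]. *)
      have [ii Ei] := integral_dirac_in mU mh (or_introl (@sector_root3 R i)).
      have [ij' Ej] := integral_dirac_in mU mh (or_intror (@sector_root3 R j)).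
      split=> //; rewrite Ei Ej (test_function_Rintegral ij ki kj th).
      by rewrite (test_function_root3 ij ki kj th) !subrr.
  (* Every [ell n] is 0 at the origin, so all the maxima are tied there and all three boundaries
     contain it. *)
  + rewrite -[RHS]card_ord; apply: eq_card => i; rewrite !inE; apply/mem_set.
    have z0 n : ell n ((0, 0) : R * R) = 0 by rewrite /ell /dotp/= !mulr0 addr0.
    have [j ji] : exists j : 'I_3, j != i.
      by case: (eqVneq i ord0) => [->|ni]; [exists ord_max|exists ord0; rewrite eq_sym].
    by apply: (boundary_sector ji) => [l|]; rewrite !z0.
  (* The origin is not a mass point: [ell i] is 1 at [root3 i] and 0 at the origin. *)
  + move=> i /su/= /(congr1 (@ell R i)); rewrite ell_root3_diag.
    by rewrite /ell /dotp/= !mulr0 addr0 => /eqP; rewrite eq_sym oner_eq0.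
Qed.
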